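(* Let $\alpha,\beta>-1$ be real numbers, let $w(t)=(1-t)^{\alpha}(1+t)^{\beta}$, and set $$N=n+\frac{\alpha+\beta+1}{2},\qquad \gamma=-\frac{(\alpha+1/2)\pi}{2}.$$ Let $m$ be a fixed nonnegative integer and let $n$ range over nonnegative integers with $n\neq m$. Then for each fixed $\theta\in(0,\pi)$, $$\int_{\cos\theta}^1 P_n^{(\alpha,\beta)}(t)\,P_m^{(\alpha,\beta)}(t)\,w(t)\,dt=\frac{\ell(\theta)}{n^{3/2}}\sin(N\theta+\gamma)+O(n^{-5/2})$$ as $n\to\infty$, where $$\ell(\theta)=\frac{2^{\alpha+\beta+1}}{\sqrt{\pi}}\left[\sin(\theta/2)\right]^{\alpha+1/2}\left[\cos(\theta/2)\right]^{\beta+1/2}P_m^{(\alpha,\beta)}(\cos\theta).$$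
   Context: For real $\alpha,\beta>-1$ and a nonnegative integer $n$, the Jacobi polynomial is $$P_n^{(\alpha,\beta)}(x)=\frac{(\alpha+1)_n}{n!}\sum_{k=0}^{n}\frac{(-n)_k(\alpha+\beta+n+1)_k}{(\alpha+1)_k\,k!}\left(\frac{1-x}{2}\right)^k,$$ where $(a)_k$ is the Pochhammer symbol: $(a)_0=1$ and $(a)_k=a(a+1)\cdots(a+k-1)$ for $k\ge 1$. The implied constant in the $O$-term may depend on $\alpha,\beta,m,\theta$ but not on $n$. *)

(* Defs.v *)
From Stdlib Require Import Reals Factorial.
From Coquelicot Require Import Coquelicot.
Open Scope R_scope.

Fixpoint pochhammer (a : R) (k : nat) : R :=
  match k with
  | O => 1
  | S j => pochhammer a j * (a + INR j)
  end.

(* [sum_f_R0 f n] is the sum of [f k] for [0 <= k <= n], endpoint included. *)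
Definition jacobi (alpha beta : R) (n : nat) (x : R) : R :=
  pochhammer (alpha + 1) n / INR (fact n) *
  sum_f_R0 (fun k =>
    pochhammer (- INR n) k * pochhammer (alpha + beta + INR n + 1) k /
    (pochhammer (alpha + 1) k * INR (fact k)) * ((1 - x) / 2) ^ k) n.

(* [Rpower] is the real power only for a positive base, which is the case here
   for [-1 < t < 1]. *)
Definition jacobi_weight (alpha beta t : R) : R :=
  Rpower (1 - t) alpha * Rpower (1 + t) beta.

Definition jacobi_integrand (alpha beta : R) (n m : nat) (t : R) : R :=
  jacobi alpha beta n t * jacobi alpha beta m t * jacobi_weight alpha beta t.

Definition jacobi_N (alpha beta : R) (n : nat) : R :=
  INR n + (alpha + beta + 1) / 2.

Definition jacobi_gamma (alpha : R) : R := - ((alpha + 1 / 2) * PI / 2).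

Definition jacobi_ell (alpha beta : R) (m : nat) (theta : R) : R :=
  Rpower 2 (alpha + beta + 1) / sqrt PI *
  Rpower (sin (theta / 2)) (alpha + 1 / 2) *
  Rpower (cos (theta / 2)) (beta + 1 / 2) *
  jacobi alpha beta m (cos theta).

(* Main.v *)
Require Import Defs.
From Stdlib Require Import Reals Factorial Lra Lia.
From Coquelicot Require Import Coquelicot.
Open Scope R_scope.

(** The Jacobi polynomials are eigenfunctions of a Sturm--Liouville operator
    with weight [w], with eigenvalues [lambda_n = n (n + alpha + beta + 1)].
    Hence, by Lagrange's identity, the integral of [P_n P_m w] from [cos theta]
    to 1 is, up to sign, the Wronskian of [P_n] and [P_m] at [cos theta], times
    [(1 - t) ^ (alpha + 1) (1 + t) ^ (beta + 1)], divided by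
    [lambda_n - lambda_m]; the contribution of the endpoint 1 vanishes because
    [alpha + 1 > 0] ([is_RInt_gen_jacobi]). As [lambda_n - lambda_m] is of order
    [n ^ 2], the claim follows once [P_n] and its derivative are known at
    [cos theta] with an error [O(1 / n)] relative to their amplitudes; the term with the derivative of
    [P_n] is larger by a factor [n] and gives the main term.

    This is Darboux's formula ([darboux]). The function
    [u x = sin (x / 2) ^ (alpha + 1/2) cos (x / 2) ^ (beta + 1/2) P_n (cos x)]
    satisfies [u'' + (N ^ 2 + q) u = 0] with
    [q x = (1/4 - alpha ^ 2) / (4 sin (x / 2) ^ 2)
         + (1/4 - beta ^ 2) / (4 cos (x / 2) ^ 2)].
    So [u] is close to a sine wave of frequency [N], and only its amplitude and
    phase have to be found. They are determined by the behaviour at 0, where the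
    perturbation is singular. On the scale [z = N x] the singular part is
    [(1/4 - alpha ^ 2) / z ^ 2], the rest is [O(N ^ -2)], and the data at
    [z = 1] are, up to [O(1 / N)], those of a Bessel function of order [alpha]
    ([approx_moment]). None of this involves [beta]. A Gronwall estimate
    ([oscillator_compare]) therefore shows that, after normalisation, changing
    [beta] changes [u] by [O(1 / N)] only ([scaled_compare]).

    Consequently [beta = -1/2] may be assumed. Then the perturbation is regular
    at the other endpoint [x = PI], and the same estimate, started there, shows
    that [u] is [P_n (-1) (cos (N (PI - x)) + O(1 / N))] ([liouville_right]). By the Chu--Vandermonde identity, [P_n (-1)] is
    [(-1) ^ n] times the central binomial coefficient of [2n] over [4 ^ n], which
    by Wallis' formula is [1 / sqrt (PI n)] with relative error [O(1 / n)]. The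
    phase [gamma] appears as [n PI - N PI]. *)

(** * Orders of magnitude of sequences *)

Definition bigO (g f : nat -> R) : Prop :=
  exists C, eventually (fun n => Rabs (f n) <= C * g n).

(** Convergence with the rate [1 / n]; unlike plain convergence, it keeps track
    of the relative error that the final estimate has to control, and it is
    stable under the same operations. *)
Definition approx (x : nat -> R) (l : R) : Prop :=
  bigO (fun n => / INR n) (fun n => x n - l).

Lemma Rinv_unit_interval x : 1 <= x -> 0 < / x <= 1.
Proof.
intros Hx; split; [apply Rinv_0_lt_compat; lra|].
rewrite <- Rinv_1; apply Rinv_le_contravar; lra.
Qed.

Lemma eventually_pos : eventually (fun n => 0 < INR n).
Proof. exists 1%nat; intros n Hn; apply lt_0_INR; lia. Qed.

Lemma eventually_ge (x : R) : eventually (fun n => x <= INR n).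
Proof.
destruct (nfloor_ex (Rmax 0 x) (Rmax_l _ _)) as [k [_ Hk]].
exists (S k); intros n Hn. apply le_INR in Hn. rewrite S_INR in Hn.
pose proof (Rmax_r 0 x); lra.
Qed.

Lemma bigO_ext_loc g f1 f2 :
  eventually (fun n => f1 n = f2 n) -> bigO g f1 -> bigO g f2.
Proof.
intros E [C H]; exists C.
generalize (filter_and _ _ E H); apply filter_imp; intros n [<- H']; exact H'.
Qed.

Lemma bigO_ext_gauge g1 g2 f :
  eventually (fun n => g1 n = g2 n) -> bigO g1 f -> bigO g2 f.
Proof.
intros E [C H]; exists C.
generalize (filter_and _ _ E H); apply filter_imp; intros n [<- H']; exact H'.
Qed.

Lemma bigO_le g f1 f2 :
  eventually (fun n => Rabs (f1 n) <= Rabs (f2 n)) -> bigO g f2 -> bigO g f1.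
Proof.
intros E [C H]; exists C.
generalize (filter_and _ _ E H); apply filter_imp; intros n [E' H']; lra.
Qed.

Lemma bigO_plus g f1 f2 : bigO g f1 -> bigO g f2 -> bigO g (fun n => f1 n + f2 n).
Proof.
intros [C1 H1] [C2 H2]; exists (C1 + C2).
generalize (filter_and _ _ H1 H2); apply filter_imp; intros n [H H'].
pose proof (Rabs_triang (f1 n) (f2 n)); lra.
Qed.

Lemma bigO_mult g1 g2 f1 f2 : bigO g1 f1 -> bigO g2 f2 ->
  bigO (fun n => g1 n * g2 n) (fun n => f1 n * f2 n).
Proof.
intros [C1 H1] [C2 H2]; exists (C1 * C2).
generalize (filter_and _ _ H1 H2); apply filter_imp; intros n [H H'].
rewrite Rabs_mult.
replace (C1 * C2 * (g1 n * g2 n)) with ((C1 * g1 n) * (C2 * g2 n)) by ring.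
apply Rmult_le_compat; auto using Rabs_pos.
Qed.

Lemma bigO_bounded_l g f1 f2 : bigO (fun _ => 1) f1 -> bigO g f2 ->
  bigO g (fun n => f1 n * f2 n).
Proof.
intros H1 H2; apply (bigO_ext_gauge (fun n => 1 * g n)).
- apply filter_forall; intros n; ring.
- now apply bigO_mult.
Qed.

Lemma bigO_bounded_r g f1 f2 : bigO g f1 -> bigO (fun _ => 1) f2 ->
  bigO g (fun n => f1 n * f2 n).
Proof.
intros H1 H2; apply (bigO_ext_loc g (fun n => f2 n * f1 n)).
- apply filter_forall; intros n; ring.
- now apply bigO_bounded_l.
Qed.

Lemma bigO_const c : bigO (fun _ => 1) (fun _ => c).
Proof. exists (Rabs c); apply filter_forall; intros n; lra. Qed.

Lemma bigO_bounded (f : nat -> R) B : (forall n, Rabs (f n) <= B) -> bigO (fun _ => 1) f.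
Proof. intros H; exists B; apply filter_forall; intros n; rewrite Rmult_1_r; apply H. Qed.

Lemma bigO_opp g f : bigO g f -> bigO g (fun n => - f n).
Proof.
intros H; apply (bigO_le g _ f); [|exact H].
apply filter_forall; intros n; rewrite Rabs_Ropp; lra.
Qed.

Lemma bigO_inv_bounded f : bigO (fun n => / INR n) f -> bigO (fun _ => 1) f.
Proof.
intros [C H]; exists (Rabs C).
generalize (filter_and _ _ (eventually_ge 1) H); apply filter_imp; intros n [H1 H'].
assert (0 < / INR n <= 1) by now apply Rinv_unit_interval.
pose proof (Rle_abs C); pose proof (Rabs_pos C); nra.
Qed.

Lemma bigO_sq f e : bigO (fun n => / INR n * / INR n) e ->
  eventually (fun n => f n ^ 2 <= Rabs (e n)) -> bigO (fun n => / INR n) f.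
Proof.
intros [C H] H'; exists (Rabs C + 1).
generalize (filter_and _ _ eventually_pos (filter_and _ _ H H')); apply filter_imp.
intros n [H0 [H1 H2]].
apply Rinv_0_lt_compat in H0; set (i := / INR n) in *.
assert (f n ^ 2 <= ((Rabs C + 1) * i) ^ 2).
{ pose proof (Rle_abs C); pose proof (Rabs_pos C).
  assert (0 < i * i) by nra.
  apply Rle_trans with (Rabs C * (i * i)); [nra|]. 
  replace (((Rabs C + 1) * i) ^ 2) with ((Rabs C + 1) ^ 2 * (i * i)) by ring.
  apply Rmult_le_compat_r; nra. }
rewrite <- (Rabs_right ((Rabs C + 1) * i)) by (pose proof (Rabs_pos C); nra).
apply Rsqr_le_abs_0; unfold Rsqr; lra.
Qed.

Lemma approx_ext_loc x y l : eventually (fun n => x n = y n) -> approx x l -> approx y l.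
Proof.
intros E; apply bigO_ext_loc. revert E; apply filter_imp; intros n ->; reflexivity.
Qed.

Lemma approx_ext x y l : (forall n, x n = y n) -> approx x l -> approx y l.
Proof. intros H; apply approx_ext_loc, filter_forall, H. Qed.

Lemma approx_const c : approx (fun _ => c) c.
Proof.
exists 0; apply filter_forall; intros n. rewrite Rminus_diag, Rabs_R0; lra.
Qed.

Lemma approx_bounded x l : approx x l -> bigO (fun _ => 1) x.
Proof.
intros H; apply (bigO_ext_loc _ (fun n => (x n - l) + l)).
- apply filter_forall; intros n; ring.
- apply bigO_plus; [now apply bigO_inv_bounded | apply bigO_const].
Qed.

Lemma approx_plus x y k l : approx x k -> approx y l -> approx (fun n => x n + y n) (k + l).
Proof.
intros H1 H2; apply (bigO_ext_loc _ (fun n => (x n - k) + (y n - l))).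
- apply filter_forall; intros n; ring.
- now apply bigO_plus.
Qed.

Lemma approx_opp x l : approx x l -> approx (fun n => - x n) (- l).
Proof.
intros H; apply (bigO_ext_loc _ (fun n => - (x n - l))).
- apply filter_forall; intros n; ring.
- now apply bigO_opp.
Qed.

Lemma approx_mult x y k l : approx x k -> approx y l -> approx (fun n => x n * y n) (k * l).
Proof.
intros H1 H2; apply (bigO_ext_loc _ (fun n => (x n - k) * y n + k * (y n - l))).
- apply filter_forall; intros n; ring.
- apply bigO_plus.
  + apply bigO_bounded_r; [exact H1 | now apply (approx_bounded y l)].
  + apply bigO_bounded_l; [apply bigO_const | exact H2].
Qed.

Lemma approx_near x l eps : 0 < eps -> approx x l ->
  eventually (fun n => Rabs (x n - l) < eps).
Proof.
intros He [C H].
generalize (filter_and _ _ (filter_and _ _ eventually_pos (eventually_ge ((Rabs C + 1) / eps))) H).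
apply filter_imp; intros n [[H0 H1] H2].
eapply Rle_lt_trans; [exact H2|].
assert (Rabs C + 1 <= eps * INR n).
{ apply (Rmult_le_compat_l eps) in H1; [|lra].
  replace (eps * ((Rabs C + 1) / eps)) with (Rabs C + 1) in H1 by (field; lra). lra. }
apply (Rmult_lt_reg_r (INR n)); [exact H0|].
rewrite Rmult_assoc, Rinv_l by lra.
pose proof (Rle_abs C); lra.
Qed.

(** A function differentiable at [l] is Lipschitz at [l]. *)
Lemma approx_comp f x l : ex_derive f l -> approx x l -> approx (fun n => f (x n)) (f l).
Proof.
intros [d Hd] H.
apply is_derive_Reals in Hd.
destruct (Hd 1 Rlt_0_1) as [delta HD].
apply (bigO_le _ _ (fun n => (Rabs d + 1) * (x n - l))).
- generalize (approx_near x l delta (cond_pos delta) H); apply filter_imp; intros n Hn.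
  rewrite Rabs_mult, (Rabs_right (Rabs d + 1)) by (pose proof (Rabs_pos d); lra).
  destruct (Req_dec (x n - l) 0) as [E|E].
  { replace (x n) with l by lra. rewrite !Rminus_diag, Rabs_R0; lra. }
  specialize (HD _ E Hn).
  replace (l + (x n - l)) with (x n) in HD by ring.
  replace (f (x n) - f l) with ((f (x n) - f l) / (x n - l) * (x n - l)) by (field; lra).
  rewrite Rabs_mult; apply Rmult_le_compat_r; [apply Rabs_pos|].
  replace ((f (x n) - f l) / (x n - l)) with
    (d + ((f (x n) - f l) / (x n - l) - d)) by ring.
  eapply Rle_trans; [apply Rabs_triang|]; lra.
- apply bigO_bounded_l; [apply bigO_const | exact H].
Qed.

Lemma approx_inv x l : l <> 0 -> approx x l -> approx (fun n => / x n) (/ l).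
Proof. intros Hl; apply (approx_comp Rinv). auto_derive; auto. Qed.

Lemma approx_Rpower x l a : 0 < l -> approx x l ->
  approx (fun n => Rpower (x n) a) (Rpower l a).
Proof. intros Hl; apply (approx_comp (fun t => Rpower t a)). unfold Rpower; auto_derive; auto. Qed.

(** * The hypergeometric polynomial *)

Definition hyp_coef (alpha beta : R) (n k : nat) : R :=
  pochhammer (- INR n) k * pochhammer (alpha + beta + INR n + 1) k /
  (pochhammer (alpha + 1) k * INR (fact k)).

(** The [i]-th power of the Euler operator [y d/dy] applied to the
    hypergeometric polynomial. With these functions the differential equation
    becomes a relation between three sums, and no derivative of a sum has to be
    reindexed. *)
Definition moment (i : nat) (alpha beta : R) (n : nat) (y : R) : R :=
  sum_f_R0 (fun k => INR k ^ i * hyp_coef alpha beta n k * y ^ k) n.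

Definition jacobi_at_one (alpha : R) (n : nat) : R :=
  pochhammer (alpha + 1) n / INR (fact n).

Lemma jacobi_moment alpha beta n x :
  jacobi alpha beta n x =
  jacobi_at_one alpha n * moment 0 alpha beta n ((1 - x) / 2).
Proof.
unfold jacobi, jacobi_at_one, moment; f_equal.
apply sum_eq; intros k _; unfold hyp_coef; simpl; ring.
Qed.

Lemma pochhammer_pos a k : 0 < a -> 0 < pochhammer a k.
Proof.
intros Ha; induction k as [|k IH]; simpl; [lra|].
apply Rmult_lt_0_compat; [exact IH|]. pose proof (pos_INR k); lra.
Qed.

Lemma jacobi_at_one_pos alpha n : -1 < alpha -> 0 < jacobi_at_one alpha n.
Proof.
intros H; unfold jacobi_at_one; apply Rdiv_lt_0_compat.
- apply pochhammer_pos; lra.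
- apply INR_fact_lt_0.
Qed.

Lemma hyp_coef_S alpha beta n k : -1 < alpha ->
  ((INR k + 1) ^ 2 + alpha * (INR k + 1)) * hyp_coef alpha beta n (S k) =
  (INR k ^ 2 + (alpha + beta + 1) * INR k - INR n * (INR n + alpha + beta + 1))
  * hyp_coef alpha beta n k.
Proof.
intros H; unfold hyp_coef.
assert (Hp := pochhammer_pos (alpha + 1) k ltac:(lra)).
assert (Hf := INR_fact_lt_0 k).
assert (Hk := pos_INR k).
rewrite fact_simpl, mult_INR, S_INR; simpl pochhammer.
field; repeat split; lra.
Qed.

(** The hypergeometric equation, in the form
    [D (D + alpha) f = y (D - n) (D + n + alpha + beta + 1) f] with
    [D = y d/dy]. *)
Lemma moment_ode alpha beta n y : -1 < alpha ->
  moment 2 alpha beta n y + alpha * moment 1 alpha beta n y =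
  y * (moment 2 alpha beta n y + (alpha + beta + 1) * moment 1 alpha beta n y
       - INR n * (INR n + alpha + beta + 1) * moment 0 alpha beta n y).
Proof.
intros H.
set (lam := INR n * (INR n + alpha + beta + 1)).
set (S_ := fun i M => sum_f_R0 (fun k => INR k ^ i * hyp_coef alpha beta n k * y ^ k) M).
(* The difference of the two sides telescopes; the remainder at [M = n]
   carries the factor [M - n]. *)
assert (T : forall M, S_ 2%nat M + alpha * S_ 1%nat M -
  y * (S_ 2%nat M + (alpha + beta + 1) * S_ 1%nat M - lam * S_ 0%nat M) =
  - (INR M ^ 2 + (alpha + beta + 1) * INR M - lam)
    * hyp_coef alpha beta n M * y ^ S M).
{ induction M as [|M IH].
  - unfold S_, lam; simpl; ring.
  - unfold S_ in *; rewrite !tech5, S_INR.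
    pose proof (hyp_coef_S alpha beta n M H) as R1.
    fold lam in R1.
    replace (y ^ S (S M)) with (y * y ^ S M) by reflexivity.
    assert (E : ((INR M + 1) ^ 2 + alpha * (INR M + 1)) *
      hyp_coef alpha beta n (S M) * y ^ S M =
      (INR M ^ 2 + (alpha + beta + 1) * INR M - lam)
      * hyp_coef alpha beta n M * y ^ S M) by (rewrite R1; ring).
    set (s0 := sum_f_R0 (fun k => INR k ^ 0 * _ * _) M) in *.
    set (s1 := sum_f_R0 (fun k => INR k ^ 1 * _ * _) M) in *.
    set (s2 := sum_f_R0 (fun k => INR k ^ 2 * _ * _) M) in *.
    clearbody s0 s1 s2.
    generalize dependent (hyp_coef alpha beta n (S M)); intros h _ E.
    generalize dependent (y ^ S M); intros p.
    generalize dependent (hyp_coef alpha beta n M); intros h' IH E.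
    lra. }
specialize (T n).
replace (INR n ^ 2 + (alpha + beta + 1) * INR n - lam) with 0 in T
  by (unfold lam; ring).
unfold S_ in T; unfold moment; fold lam; lra.
Qed.

Lemma is_derive_moment i alpha beta n y : y <> 0 ->
  is_derive (moment i alpha beta n) y (moment (S i) alpha beta n y / y).
Proof.
intros Hy; unfold moment.
induction n as [|M IH] at 2 4.
- simpl. apply (is_derive_ext (fun _ => INR 0 ^ i * hyp_coef alpha beta n 0 * 1)).
  + intros t; reflexivity.
  + replace (0 * 0 ^ i * hyp_coef alpha beta n 0 * 1 / y) with 0 by (field; auto).
    apply is_derive_Reals, derivable_pt_lim_const.
- rewrite tech5, Rdiv_plus_distr.
  apply (is_derive_plus (V := R_NormedModule) _
    (fun t => INR (S M) ^ i * hyp_coef alpha beta n (S M) * t ^ S M)); [exact IH|].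
  replace (INR (S M) ^ S i * hyp_coef alpha beta n (S M) * y ^ S M / y) with
   (INR (S M) ^ i * hyp_coef alpha beta n (S M) * (INR (S M) * 1 * y ^ M))
    by (rewrite <- !tech_pow_Rmult; field; auto).
  apply (is_derive_scal (fun t => t ^ S M)).
  auto_derive; [exact I|]. simpl; ring.
Qed.

Lemma pochhammer_shift a k : pochhammer a (S k) = a * pochhammer (a + 1) k.
Proof.
induction k as [|k IH]; [simpl; ring|].
change (pochhammer a (S k) * (a + INR (S k)) =
        a * (pochhammer (a + 1) k * (a + 1 + INR k))).
rewrite IH, S_INR; ring.
Qed.

Lemma pochhammer_neg_nat n k : (n < k)%nat -> pochhammer (- INR n) k = 0.
Proof.
induction k as [|k IH]; [lia|]; intros H; simpl.
destruct (Nat.eq_dec n k) as [->|E]; [ring|].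
rewrite IH by lia; ring.
Qed.

(** Chu--Vandermonde, by Pascal's rule in the form
    [(-(n+1))_k / k! = (-n)_k / k! - (-n)_(k-1) / (k-1)!]. *)
Lemma chu_vandermonde n b c M : 0 < c -> (n <= M)%nat ->
  sum_f_R0 (fun k => pochhammer (- INR n) k * pochhammer b k /
    (pochhammer c k * INR (fact k))) M = pochhammer (c - b) n / pochhammer c n.
Proof.
revert b c M; induction n as [|n IH]; intros b c M Hc HM.
- clear HM; induction M as [|M IHM]; [simpl; field|].
  rewrite tech5, IHM, (pochhammer_neg_nat 0 (S M)) by lia. unfold Rdiv; ring.
- destruct M as [|M]; [lia|].
  assert (Hn := pochhammer_pos c n Hc).
  assert (Hn1 := pochhammer_pos (c + 1) n ltac:(lra)).
  assert (Hin := pos_INR n).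
  (* Pascal's rule, summed *)
  assert (P : sum_f_R0 (fun k => pochhammer (- INR (S n)) k * pochhammer b k /
      (pochhammer c k * INR (fact k))) (S M) =
    sum_f_R0 (fun k => pochhammer (- INR n) k * pochhammer b k /
      (pochhammer c k * INR (fact k))) (S M) -
    b / c * sum_f_R0 (fun k => pochhammer (- INR n) k * pochhammer (b + 1) k /
      (pochhammer (c + 1) k * INR (fact k))) M).
  { clear HM; assert (T : forall k, pochhammer (- INR (S n)) (S k) * pochhammer b (S k) /
      (pochhammer c (S k) * INR (fact (S k))) =
      pochhammer (- INR n) (S k) * pochhammer b (S k) /
      (pochhammer c (S k) * INR (fact (S k))) -
      b / c * (pochhammer (- INR n) k * pochhammer (b + 1) k /
      (pochhammer (c + 1) k * INR (fact k)))).
    { intros k. rewrite (pochhammer_shift (- INR (S n))), (pochhammer_shift b),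
        (pochhammer_shift c), S_INR.
      replace (- (INR n + 1) + 1) with (- INR n) by ring.
      rewrite fact_simpl, mult_INR, S_INR; simpl pochhammer.
      assert (Hk := pochhammer_pos (c + 1) k ltac:(lra)).
      assert (Hf := INR_fact_lt_0 k). assert (Hik := pos_INR k).
      field; lra. }
    induction M as [|M IHM].
    - rewrite !tech5, T. simpl. field. lra.
    - rewrite 2!(tech5 _ (S M)), IHM, T, (tech5 (fun k => _ * pochhammer (b + 1) k / _) M).
      ring. }
  rewrite P, (IH b c (S M) Hc), (IH (b + 1) (c + 1) M) by (lra || lia).
  replace (c + 1 - (b + 1)) with (c - b) by ring.
  assert (E : pochhammer c n * (c + INR n) = c * pochhammer (c + 1) n)
    by (rewrite <- pochhammer_shift; reflexivity).
  simpl pochhammer.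
  replace (pochhammer (c + 1) n) with (pochhammer c n * (c + INR n) / c)
    by (rewrite E; field; lra).
  field; lra.
Qed.

Lemma pochhammer_reflect b n :
  pochhammer (- INR n - b) n = (-1) ^ n * pochhammer (b + 1) n.
Proof.
induction n as [|n IH] in b |- *; [simpl; ring|].
rewrite pochhammer_shift, S_INR.
replace (- (INR n + 1) - b + 1) with (- INR n - b) by ring.
rewrite IH; simpl; ring.
Qed.

(** The point [y = 1] is the endpoint [x = -1] of the Jacobi variable. *)
Lemma moment0_at_1 alpha beta n : -1 < alpha ->
  moment 0 alpha beta n 1 =
  (-1) ^ n * pochhammer (beta + 1) n / pochhammer (alpha + 1) n.
Proof.
intros H.
rewrite <- pochhammer_reflect.
replace (- INR n - beta) with (alpha + 1 - (alpha + beta + INR n + 1)) by ring.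
rewrite <- (chu_vandermonde n _ (alpha + 1) n) by (lra || lia).
apply sum_eq; intros k _; unfold hyp_coef; rewrite pow1; simpl; ring.
Qed.

(** * The Liouville normal form *)

(** With [N = n + (alpha + beta + 1) / 2], the prefactor turns the Jacobi
    equation in the angle [x] into [u'' + (N ^ 2 + q x) u = 0], where [q] is
    [potential] below. The polynomial is normalised to the value 1 at [x = 0]. *)
Definition liouville (alpha beta : R) (n : nat) (x : R) : R :=
  Rpower (sin (x / 2)) (alpha + 1 / 2) * Rpower (cos (x / 2)) (beta + 1 / 2)
  * moment 0 alpha beta n (sin (x / 2) ^ 2).

Definition liouville' (alpha beta : R) (n : nat) (x : R) : R :=
  Rpower (sin (x / 2)) (alpha + 1 / 2) * Rpower (cos (x / 2)) (beta + 1 / 2)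
  * (cos (x / 2) / sin (x / 2) *
       (moment 1 alpha beta n (sin (x / 2) ^ 2)
        + (alpha + 1 / 2) / 2 * moment 0 alpha beta n (sin (x / 2) ^ 2))
     - (beta + 1 / 2) / 2 * (sin (x / 2) / cos (x / 2))
       * moment 0 alpha beta n (sin (x / 2) ^ 2)).

Definition potential (alpha beta x : R) : R :=
  (1 / 4 - alpha ^ 2) / (4 * sin (x / 2) ^ 2)
  + (1 / 4 - beta ^ 2) / (4 * cos (x / 2) ^ 2).

Lemma half_angle_pos x : 0 < x < PI -> 0 < sin (x / 2) /\ 0 < cos (x / 2).
Proof.
intros Hx; split; [apply sin_gt_0 | apply cos_gt_0]; lra.
Qed.

Lemma is_derive_moment_sin i alpha beta n x : 0 < x < PI ->
  is_derive (fun t => moment i alpha beta n (sin (t / 2) ^ 2)) x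
    (cos (x / 2) / sin (x / 2) * moment (S i) alpha beta n (sin (x / 2) ^ 2)).
Proof.
intros Hx; destruct (half_angle_pos x Hx) as [Hs Hc].
replace (cos (x / 2) / sin (x / 2) * moment (S i) alpha beta n (sin (x / 2) ^ 2))
  with (sin (x / 2) * cos (x / 2) *
    (moment (S i) alpha beta n (sin (x / 2) ^ 2) / sin (x / 2) ^ 2)) by (field; lra).
apply (is_derive_comp (moment i alpha beta n) (fun t => sin (t / 2) ^ 2)).
- apply is_derive_moment; nra.
- auto_derive; [exact I|]. unfold Rdiv; field.
Qed.

Lemma is_derive_prefactor a b x : 0 < x < PI ->
  is_derive (fun t => Rpower (sin (t / 2)) a * Rpower (cos (t / 2)) b) x
    (Rpower (sin (x / 2)) a * Rpower (cos (x / 2)) b *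
     (a / 2 * (cos (x / 2) / sin (x / 2)) - b / 2 * (sin (x / 2) / cos (x / 2)))).
Proof.
intros Hx; destruct (half_angle_pos x Hx) as [Hs Hc].
unfold Rpower; auto_derive.
- unfold Rdiv in Hs, Hc; repeat split; auto.
- unfold Rdiv in *; field; lra.
Qed.

Lemma is_derive_liouville alpha beta n x : 0 < x < PI ->
  is_derive (liouville alpha beta n) x (liouville' alpha beta n x).
Proof.
intros Hx; destruct (half_angle_pos x Hx) as [Hs Hc].
pose proof (is_derive_prefactor (alpha + 1 / 2) (beta + 1 / 2) x Hx) as D1.
pose proof (is_derive_moment_sin 0 alpha beta n x Hx) as D2.
pose proof (is_derive_mult _ _ _ _ _ D1 D2 Rmult_comm) as D.
unfold liouville; evar_last; [exact D|].
unfold liouville', plus, mult; simpl. field; lra.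
Qed.

(** The prefactor removes the first-order term of the Jacobi equation, and
    completing the square in the eigenvalue produces [N]. *)
Lemma is_derive_liouville' alpha beta n x : -1 < alpha -> 0 < x < PI ->
  is_derive (liouville' alpha beta n) x
    (- (jacobi_N alpha beta n ^ 2 + potential alpha beta x) * liouville alpha beta n x).
Proof.
intros Ha Hx; destruct (half_angle_pos x Hx) as [Hs Hc].
pose proof (is_derive_prefactor (alpha + 1 / 2) (beta + 1 / 2) x Hx) as D1.
pose proof (is_derive_moment_sin 0 alpha beta n x Hx) as D2.
pose proof (is_derive_moment_sin 1 alpha beta n x Hx) as D3.
assert (D4 : is_derive (fun t => cos (t / 2) / sin (t / 2)) x
   (- (1 / (2 * sin (x / 2) ^ 2)))).
{ auto_derive; unfold Rdiv in *; [lra|].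
  pose proof (sin2_cos2 (x * / 2)) as E; unfold Rsqr in E.
  replace (1 * / (2 * sin (x * / 2) ^ 2)) with ((sin (x * / 2) * sin (x * / 2) +
     cos (x * / 2) * cos (x * / 2)) * / (2 * sin (x * / 2) ^ 2)) by (rewrite E; reflexivity).
  field; lra. }
assert (D5 : is_derive (fun t => sin (t / 2) / cos (t / 2)) x
   (1 / (2 * cos (x / 2) ^ 2))).
{ auto_derive; unfold Rdiv in *; [lra|].
  pose proof (sin2_cos2 (x * / 2)) as E; unfold Rsqr in E.
  replace (1 * / (2 * cos (x * / 2) ^ 2)) with ((sin (x * / 2) * sin (x * / 2) +
     cos (x * / 2) * cos (x * / 2)) * / (2 * cos (x * / 2) ^ 2)) by (rewrite E; reflexivity).
  field; lra. }
pose proof (is_derive_scal _ _ ((alpha + 1 / 2) / 2) _ D2) as D2a.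
pose proof (is_derive_plus _ _ _ _ _ D3 D2a) as D6.
pose proof (is_derive_mult _ _ _ _ _ D4 D6 Rmult_comm) as D7.
pose proof (is_derive_scal _ _ ((beta + 1 / 2) / 2) _ D5) as D5a.
pose proof (is_derive_mult _ _ _ _ _ D5a D2 Rmult_comm) as D8.
pose proof (is_derive_minus _ _ _ _ _ D7 D8) as D9.
pose proof (is_derive_mult _ _ _ _ _ D1 D9 Rmult_comm) as D.
clear D1 D2 D3 D4 D5 D6 D7 D8 D9 D2a D5a.
unfold liouville'; evar_last; [exact D|]; clear D.
unfold plus, minus, mult, opp; simpl.
unfold liouville, potential, jacobi_N, opp; simpl.
pose proof (moment_ode alpha beta n (sin (x / 2) ^ 2) Ha) as O.
pose proof (sin2_cos2 (x / 2)) as E; unfold Rsqr in E.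
simpl in O.
set (s := sin (x / 2)) in *; set (c := cos (x / 2)) in *.
set (W := Rpower s (alpha + 1 / 2) * Rpower c (beta + 1 / 2)).
clearbody W.
generalize dependent (moment 2 alpha beta n (s * (s * 1))); intros m2.
generalize dependent (moment 1 alpha beta n (s * (s * 1))); intros m1.
generalize dependent (moment 0 alpha beta n (s * (s * 1))); intros m0 O.
replace (s * (s * 1)) with (s * s) by ring.
replace (s * (s * 1)) with (s * s) in O by ring.
replace (c * (c * 1)) with (c * c) by ring.
assert (Hm : m2 = (- alpha * m1 + s * s * ((alpha + beta + 1) * m1
   - INR n * (INR n + alpha + beta + 1) * m0)) / (c * c)).
{ apply (Rmult_eq_reg_r (c * c)); [|nra].
  replace (c * c) with (1 - s * s) at 1 by lra. field_simplify; [|nra].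
  replace (c * c) with (1 - s * s) by lra. lra. }
unfold plus; simpl.
transitivity (W * ((alpha + 1 / 2) / 2 * (c * c / (s * s)) * (m1 + (alpha + 1 / 2) / 2 * m0)
  - (alpha + 1 / 2) * (beta + 1 / 2) / 4 * m0
  - (beta + 1 / 2) / 2 * (m1 + (alpha + 1 / 2) / 2 * m0)
  + (beta + 1 / 2) ^ 2 / 4 * (s * s / (c * c)) * m0
  - (m1 + (alpha + 1 / 2) / 2 * m0) / (2 * (s * s))
  + c * c / (s * s) * m2 + (alpha + 1 / 2) / 2 * (c * c / (s * s)) * m1
  - (beta + 1 / 2) / 2 / (2 * (c * c)) * m0 - (beta + 1 / 2) / 2 * m1)).
{ field; lra. }
rewrite Hm.
assert (Hu : 0 < s * s) by nra. assert (Hv : 0 < c * c) by nra.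
replace (c * c) with (1 - s * s) in * by lra.
generalize dependent (s * s); intros u; intros.
field; lra.
Qed.

(** * Comparison of perturbed oscillators *)

Lemma decreasing_of_derive (f f' : R -> R) t0 t1 : t0 <= t1 ->
  (forall z, t0 <= z <= t1 -> is_derive f z (f' z)) ->
  (forall z, t0 <= z <= t1 -> f' z <= 0) -> f t1 <= f t0.
Proof.
intros Ht Hd Hn.
destruct (MVT_gen f t0 t1 f') as [z [Hz E]].
- intros x Hx; apply Hd; rewrite Rmin_left, Rmax_right in Hx by lra; lra.
- intros x Hx; rewrite Rmin_left, Rmax_right in Hx by lra.
  apply continuity_pt_filterlim, (ex_derive_continuous f).
  exists (f' x); apply Hd; lra.
- rewrite Rmin_left, Rmax_right in Hz by lra.
  specialize (Hn z Hz); nra.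
Qed.

(** The rate [nu / z ^ 2] has the bounded primitive [- nu / z] at infinity, so
    it contributes only the factor [exp (nu / t0)], however long the interval. *)
Lemma gronwall (E E' : R -> R) nu c d t0 t1 :
  0 < t0 <= t1 -> 0 <= nu -> 0 <= c -> 0 <= d -> 0 <= E t0 ->
  (forall z, t0 <= z <= t1 -> is_derive E z (E' z)) ->
  (forall z, t0 <= z <= t1 -> E' z <= (nu / z ^ 2 + c) * E z + d) ->
  E t1 <= exp (nu / t0 + c * t1) * (E t0 + d * t1).
Proof.
intros Ht Hnu Hc Hd H0 HE HE'.
set (K := fun z => nu / t0 - nu / z + c * (z - t0)).
assert (K0 : forall z, t0 <= z <= t1 -> 0 <= K z).
{ intros z Hz; unfold K.
  assert (nu / z <= nu / t0).
  { apply Rmult_le_compat_l; [lra|]. apply Rinv_le_contravar; lra. }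
  assert (0 <= c * (z - t0)) by (apply Rmult_le_pos; lra). lra. }
assert (D : E t1 * exp (- K t1) - d * t1 <= E t0 * exp (- K t0) - d * t0).
{ apply (decreasing_of_derive (fun z => E z * exp (- K z) - d * z)
    (fun z => exp (- K z) * (E' z - (nu / z ^ 2 + c) * E z) - d)); [lra| |].
  - intros z Hz.
    assert (DK : is_derive (fun z => exp (- K z)) z (exp (- K z) * - (nu / z ^ 2 + c))).
    { assert (DK0 : is_derive (fun z => - K z) z (- (nu / z ^ 2 + c)))
        by (unfold K; auto_derive; [lra | field; lra]).
      evar_last; [exact (is_derive_comp _ _ _ _ _ (is_derive_exp _) DK0)|].
      apply Rmult_comm. }
    pose proof (is_derive_mult _ _ _ _ _ (HE z Hz) DK Rmult_comm) as D1.
    assert (D2 : is_derive (fun z => d * z) z d) by (auto_derive; [exact I|ring]).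
    pose proof (is_derive_minus _ _ _ _ _ D1 D2) as D3.
    evar_last; [exact D3|].
    unfold minus, plus, mult, opp; simpl; unfold plus; simpl. ring.
  - intros z Hz; specialize (HE' z Hz).
    assert (exp (- K z) <= 1).
    { rewrite <- exp_0. specialize (K0 z Hz).
      destruct (Req_dec (K z) 0) as [->|N]; [rewrite Ropp_0; lra|].
      left; apply exp_increasing; lra. }
    pose proof (exp_pos (- K z)). nra. }
replace (K t0) with 0 in D by (unfold K; ring).
rewrite Ropp_0, exp_0 in D.
assert (B : E t1 * exp (- K t1) <= E t0 + d * t1) by nra.
assert (B2 : E t1 <= exp (K t1) * (E t0 + d * t1)).
{ replace (E t1) with (exp (K t1) * (E t1 * exp (- K t1))).
  - apply Rmult_le_compat_l; [left; apply exp_pos | exact B].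
  - rewrite exp_Ropp; field. apply Rgt_not_eq, exp_pos. }
eapply Rle_trans; [exact B2|].
apply Rmult_le_compat_r.
- assert (0 <= d * t1) by (apply Rmult_le_pos; lra). lra.
- assert (L : K t1 <= nu / t0 + c * t1).
  { unfold K. assert (0 <= nu / t1) by (apply Rmult_le_pos; [lra| left; apply Rinv_0_lt_compat; lra]).
    assert (0 <= c * t0) by (apply Rmult_le_pos; lra). lra. }
  destruct (Rle_lt_or_eq_dec _ _ L) as [L'| ->]; [left; apply exp_increasing; lra | lra].
Qed.

(** Both functions solve [F'' + (1 + nu / z ^ 2 + O(M ^ -2)) F = 0]. The
    singular term [nu / z ^ 2] is the same in both equations and integrable at
    infinity, and the remaining perturbation acts over a length [O(M)]; so the
    solutions, if they start at distance [O(1 / M)], stay at that distance. The estimate is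
    on the energy [(F1 - F2) ^ 2 + (G1 - G2) ^ 2]. *)
Lemma oscillator_compare (F1 G1 F2 G2 rho1 rho2 : R -> R) nu c B M tau t0 t1 :
  0 < t0 <= t1 -> 1 <= M -> t1 <= tau * M -> 0 <= c -> 0 <= B ->
  (forall z, t0 <= z <= t1 -> is_derive F1 z (G1 z)) ->
  (forall z, t0 <= z <= t1 -> is_derive G1 z (- (1 + nu / z ^ 2 + rho1 z) * F1 z)) ->
  (forall z, t0 <= z <= t1 -> is_derive F2 z (G2 z)) ->
  (forall z, t0 <= z <= t1 -> is_derive G2 z (- (1 + nu / z ^ 2 + rho2 z) * F2 z)) ->
  (forall z, t0 <= z <= t1 -> Rabs (rho1 z) <= c / M ^ 2) ->
  (forall z, t0 <= z <= t1 -> Rabs (rho2 z) <= c / M ^ 2) ->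
  (forall z, t0 <= z <= t1 -> Rabs (F2 z) <= B) ->
  (F1 t1 - F2 t1) ^ 2 + (G1 t1 - G2 t1) ^ 2 <=
  exp (Rabs nu / t0 + (c + 2 * c * B) * tau) *
  ((F1 t0 - F2 t0) ^ 2 + (G1 t0 - G2 t0) ^ 2 + 2 * c * B * tau / M ^ 2).
Proof.
intros Ht HM Htau Hc HB DF1 DG1 DF2 DG2 R1 R2 BF2.
set (E := fun z => (F1 z - F2 z) ^ 2 + (G1 z - G2 z) ^ 2).
set (E' := fun z => 2 * (F1 z - F2 z) * (G1 z - G2 z) + 2 * (G1 z - G2 z) *
  (- (1 + nu / z ^ 2 + rho1 z) * F1 z + (1 + nu / z ^ 2 + rho2 z) * F2 z)).
assert (Epos : forall z, 0 <= E z) 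
  by (intros z; apply Rplus_le_le_0_compat; apply pow2_ge_0).
assert (HcB : 0 <= c * B) by (apply Rmult_le_pos; lra).
assert (HMi : 0 < / M <= 1) by now apply Rinv_unit_interval.
pose proof (gronwall E E' (Rabs nu) ((c + 2 * c * B) / M) (2 * c * B / M ^ 3) t0 t1 Ht
  (Rabs_pos nu)) as G.
assert (P3 : 0 <= / M ^ 3) by (left; apply Rinv_0_lt_compat, pow_lt; lra).
eapply Rle_trans; [apply G|]; clear G.
- apply Rmult_le_pos; lra.
- apply Rmult_le_pos; lra.
- apply Epos.
- intros z Hz; unfold E.
  pose proof (is_derive_minus _ _ _ _ _ (DF1 z Hz) (DF2 z Hz)) as D1.
  pose proof (is_derive_minus _ _ _ _ _ (DG1 z Hz) (DG2 z Hz)) as D2.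
  pose proof (is_derive_plus _ _ _ _ _ (is_derive_pow _ 2 _ _ D1) (is_derive_pow _ 2 _ _ D2)) as D.
  evar_last; [exact D|].
  unfold minus, plus, opp, E'; simpl; unfold plus; simpl. ring.
- intros z Hz; unfold E', E.
  specialize (R1 z Hz); specialize (R2 z Hz); specialize (BF2 z Hz).
  set (D := F1 z - F2 z); set (H := G1 z - G2 z).
  assert (HD2 := pow2_ge_0 D). assert (HH2 := pow2_ge_0 H).
  replace (2 * D * H + 2 * H * (- (1 + nu / z ^ 2 + rho1 z) * F1 z +
    (1 + nu / z ^ 2 + rho2 z) * F2 z)) with
   ((nu / z ^ 2 + rho1 z) * (- (2 * D * H)) + (rho2 z - rho1 z) * F2 z * (2 * H))
   by (unfold D, H; ring).
  assert (Hz2 : 0 < / z ^ 2) by (apply Rinv_0_lt_compat, pow_lt; lra).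
  assert (A1 : (nu / z ^ 2 + rho1 z) * (- (2 * D * H)) <=
     (Rabs nu / z ^ 2 + c / M ^ 2) * (D ^ 2 + H ^ 2)).
  { eapply Rle_trans; [apply Rle_abs|]. rewrite Rabs_mult.
    apply Rmult_le_compat; try apply Rabs_pos.
    - eapply Rle_trans; [apply Rabs_triang|]. apply Rplus_le_compat; [|exact R1].
      unfold Rdiv; rewrite Rabs_mult, (Rabs_right (/ z ^ 2)) by lra. lra.
    - pose proof (pow2_ge_0 (D - H)); pose proof (pow2_ge_0 (D + H)).
      apply Rabs_le; split; lra. }
  assert (A2 : (rho2 z - rho1 z) * F2 z * (2 * H) <=
     (2 * c / M ^ 2 * B) * (Rabs (2 * H))).
  { eapply Rle_trans; [apply Rle_abs|]. rewrite (Rabs_mult _ (2 * H)), Rabs_mult.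
    apply Rmult_le_compat; try apply Rabs_pos.
    - apply Rmult_le_pos; apply Rabs_pos.
    - apply Rmult_le_compat; try apply Rabs_pos; [|exact BF2].
      unfold Rminus; eapply Rle_trans; [apply Rabs_triang|]. rewrite Rabs_Ropp.
      unfold Rdiv in *; lra.
    - lra. }
  (* [2 |H| / M ^ 2 <= (H ^ 2 + 1 / M ^ 2) / M] *)
  assert (A3 : 2 * c / M ^ 2 * B * Rabs (2 * H) <=
     2 * (c * B) * (/ M * (H ^ 2 + (/ M) ^ 2))).
  { replace (2 * c / M ^ 2 * B * Rabs (2 * H)) with
      (2 * (c * B) * (/ M * (/ M * Rabs (2 * H)))) by (field; lra).
    apply Rmult_le_compat_l; [lra|]. apply Rmult_le_compat_l; [lra|].
    assert (Rabs (2 * H) = 2 * Rabs H) as -> by (rewrite Rabs_mult, Rabs_right; lra).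
    rewrite <- (pow2_abs H).
    pose proof (pow2_ge_0 (Rabs H - / M)). nra. }
  assert (A4 : c / M ^ 2 * (D ^ 2 + H ^ 2) <= c / M * (D ^ 2 + H ^ 2)).
  { apply Rmult_le_compat_r; [nra|]. unfold Rdiv; apply Rmult_le_compat_l; [lra|].
    replace (/ M ^ 2) with (/ M * / M) by (field; lra). nra. }
  assert (A5 : 2 * (c * B) * (/ M * (H ^ 2 + (/ M) ^ 2)) <=
     2 * c * B / M * (D ^ 2 + H ^ 2) + 2 * c * B / M ^ 3).
  { replace (2 * (c * B) * (/ M * (H ^ 2 + (/ M) ^ 2))) with
     (2 * c * B / M * H ^ 2 + 2 * c * B / M ^ 3) by (field; lra).
    apply Rplus_le_compat_r. apply Rmult_le_compat_l; [|nra].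
    apply Rmult_le_pos; lra. }
  replace ((Rabs nu / z ^ 2 + (c + 2 * c * B) / M) * (D ^ 2 + H ^ 2)) with
    (Rabs nu / z ^ 2 * (D ^ 2 + H ^ 2) + c / M * (D ^ 2 + H ^ 2)
      + 2 * c * B / M * (D ^ 2 + H ^ 2)) by (field; lra).
  replace ((Rabs nu / z ^ 2 + c / M ^ 2) * (D ^ 2 + H ^ 2)) with
    (Rabs nu / z ^ 2 * (D ^ 2 + H ^ 2) + c / M ^ 2 * (D ^ 2 + H ^ 2)) in A1 by ring.
  lra.
- assert (L : forall x y, x <= y -> exp x <= exp y).
  { intros x y [L| ->]; [left; apply exp_increasing; lra | lra]. }
  assert (T : t1 / M <= tau).
  { apply (Rmult_le_reg_r M); [lra|]. unfold Rdiv; rewrite Rmult_assoc, Rinv_l; lra. }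
  apply Rmult_le_compat; [left; apply exp_pos | | apply L |].
  + assert (0 <= 2 * c * B / M ^ 3 * t1) by (apply Rmult_le_pos; [apply Rmult_le_pos; lra | lra]).
    specialize (Epos t0); lra.
  + apply Rplus_le_compat_l.
    replace ((c + 2 * c * B) / M * t1) with ((c + 2 * c * B) * (t1 / M)) by (field; lra).
    apply Rmult_le_compat_l; lra.
  + unfold E; apply Rplus_le_compat_l.
    replace (2 * c * B / M ^ 3 * t1) with (2 * c * B / M ^ 2 * (t1 / M)) by (field; lra).
    replace (2 * c * B * tau / M ^ 2) with (2 * c * B / M ^ 2 * tau) by (field; lra).
    apply Rmult_le_compat_l; [|exact T].
    apply Rmult_le_pos; [lra|]. left; apply Rinv_0_lt_compat, pow_lt; lra.
Qed.

(** * Behaviour at distance [1 / N] from the endpoint *)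

Lemma sin_ge_cubic x : 0 <= x -> x - x ^ 3 / 6 <= sin x.
Proof.
intros Hx.
assert (sin_le : forall u, 0 <= u -> Rabs (sin u) <= u).
{ intros u Hu; apply Rabs_le; split.
  - destruct (Rle_lt_dec PI u) as [L|L].
    + pose proof (SIN_bound u); pose proof PI2_1. unfold PI2 in *; lra.
    + pose proof (sin_ge_0 u Hu ltac:(lra)); lra.
  - destruct (Rle_lt_or_eq_dec 0 u Hu) as [L|<-]; [left; now apply sin_lt_x|].
    rewrite sin_0; lra. }
pose proof (decreasing_of_derive (fun t => t - t ^ 3 / 6 - sin t)
  (fun t => 1 - t ^ 2 / 2 - cos t) 0 x Hx) as D.
cbv beta in D. rewrite sin_0 in D. cut (x - x ^ 3 / 6 - sin x <= 0 - 0 ^ 3 / 6 - 0); [lra|].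
apply D.
- intros z Hz; auto_derive; [exact I|]. field.
- intros z Hz. replace z with (2 * (z / 2)) at 2 by field.
  rewrite cos_2a_sin.
  pose proof (sin_le (z / 2) ltac:(lra)) as L.
  pose proof (Rabs_pos (sin (z / 2))).
  assert (sin (z / 2) ^ 2 <= (z / 2) ^ 2).
  { rewrite <- pow2_abs; apply pow_incr; lra. }
  lra.
Qed.

(** Dominated comparison of a finite sum with a series: the factors [rho] cut
    the series off after [n] and are otherwise close to 1. *)
Lemma sum_perturb (a b rho : nat -> R) n D eps : ex_series a -> 0 <= eps ->
  (forall k, (n < k)%nat -> rho k = 0) ->
  (forall k, Rabs (a k) * Rabs (rho k - 1) <= b k * eps) ->
  (forall M, sum_f_R0 b M <= D) ->
  Rabs (sum_f_R0 (fun k => a k * rho k) n - Series a) <= D * eps.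
Proof.
intros Ha He Hrho Hb HD.
set (S1 := sum_f_R0 (fun k => a k * rho k) n).
assert (St : forall M, (n <= M)%nat -> sum_f_R0 (fun k => a k * rho k) M = S1).
{ intros M HM; induction M as [|M IH].
  - assert (n = 0)%nat by lia; subst n; reflexivity.
  - destruct (Nat.eq_dec n (S M)) as [<-|E]; [reflexivity|].
    rewrite tech5, IH, Hrho by lia; ring. }
assert (L : is_lim_seq (fun M => Rabs (S1 - sum_f_R0 a M)) (Rabs (S1 - Series a))).
{ apply (is_lim_seq_abs _ (Finite (S1 - Series a))).
  apply is_lim_seq_minus'; [apply is_lim_seq_const|].
  apply (is_lim_seq_ext (sum_n a)); [intros M; apply sum_n_Reals|].
  apply Series_correct, Ha. }
change (Rbar_le (Rabs (S1 - Series a)) (D * eps)).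
apply (is_lim_seq_le_loc _ (fun _ => D * eps) _ _) with (2 := L);
  [|apply is_lim_seq_const].
exists n; intros M HM. rewrite <- (St M HM).
rewrite <- minus_sum.
eapply Rle_trans; [apply Rabs_triang_gen|].
apply Rle_trans with (sum_f_R0 (fun k => b k * eps) M).
- apply sum_Rle; intros k _.
  replace (a k * rho k - a k) with (a k * (rho k - 1)) by ring.
  rewrite Rabs_mult; apply Hb.
- rewrite <- scal_sum, Rmult_comm; apply Rmult_le_compat_r; [exact He | apply HD].
Qed.

Definition bessel_coef (alpha : R) (k : nat) : R :=
  (-1) ^ k / (4 ^ k * (pochhammer (alpha + 1) k * INR (fact k))).

(** Up to a constant factor, the value at [z = 1] of
    [(z / 2 * d/dz) ^ i (z ^ - alpha * J_alpha z)], with [J_alpha] the Bessel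
    function. *)
Definition bessel_moment (i : nat) (alpha : R) : R :=
  Series (fun k => INR k ^ i * bessel_coef alpha k).

Lemma pochhammer_ge alpha k : -1 < alpha ->
  Rmin 1 (alpha + 1) <= pochhammer (alpha + 1) k.
Proof.
intros H.
assert (Hm := Rmin_l 1 (alpha + 1)). assert (Hm' := Rmin_r 1 (alpha + 1)).
destruct k as [|k]; [simpl; exact Hm|].
apply Rle_trans with (alpha + 1); [exact Hm'|].
induction k as [|k IH]; [simpl; lra|].
change (alpha + 1 <= pochhammer (alpha + 1) (S k) * (alpha + 1 + INR (S k))).
rewrite S_INR; pose proof (pos_INR k); nra.
Qed.

Lemma INR_S_le_pow2 k : INR k + 1 <= 2 ^ k.
Proof.
induction k as [|k IH]; [simpl; lra|].
rewrite S_INR; simpl. pose proof (pos_INR k); lra.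
Qed.

Lemma bessel_coef_bound alpha k : -1 < alpha ->
  Rabs (bessel_coef alpha k) <=
  / Rmin 1 (alpha + 1) * (/ 4 ^ k * / INR (fact k)).
Proof.
intros H; unfold bessel_coef, Rdiv.
assert (Hm : 0 < Rmin 1 (alpha + 1)) by (apply Rmin_pos; lra).
pose proof (pochhammer_ge alpha k H) as Hp.
pose proof (INR_fact_lt_0 k) as Hf.
pose proof (pow_lt 4 k ltac:(lra)) as H4.
rewrite Rabs_mult, pow_1_abs, Rmult_1_l.
assert (P : 0 < 4 ^ k * (pochhammer (alpha + 1) k * INR (fact k)))
  by (repeat apply Rmult_lt_0_compat; lra).
rewrite Rabs_right by (left; now apply Rinv_0_lt_compat).
rewrite !Rinv_mult.
assert (/ pochhammer (alpha + 1) k <= / Rmin 1 (alpha + 1))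
  by (apply Rinv_le_contravar; lra).
apply Rinv_0_lt_compat in H4; apply Rinv_0_lt_compat in Hf.
rewrite (Rmult_comm (/ Rmin 1 _)), Rmult_assoc.
apply Rmult_le_compat_l; [lra|]. rewrite Rmult_comm; apply Rmult_le_compat_l; lra.
Qed.

Lemma exp_series x : is_series (fun k => x ^ k * / INR (fact k)) (exp x).
Proof.
pose proof (is_exp_Reals x) as H.
unfold is_pseries in H; revert H; apply is_series_ext; intros k.
unfold scal; simpl; unfold mult; simpl. now rewrite pow_n_pow.
Qed.

Lemma exp_partial_sums x M : 0 <= x -> sum_f_R0 (fun k => x ^ k * / INR (fact k)) M <= exp x.
Proof.
intros Hx; apply sum_incr.
- apply is_lim_seq_Reals. apply (is_lim_seq_ext (sum_n (fun k => x ^ k * / INR (fact k)))).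
  + intros n; apply sum_n_Reals.
  + apply exp_series.
- intros k; apply Rmult_le_pos; [now apply pow_le|].
  left; apply Rinv_0_lt_compat, INR_fact_lt_0.
Qed.

Lemma ex_series_bessel i alpha : -1 < alpha ->
  ex_series (fun k => INR k ^ i * bessel_coef alpha k).
Proof.
intros H.
apply (ex_series_le (V := R_CompleteNormedModule) _
  (fun k => / Rmin 1 (alpha + 1) * ((2 ^ i) ^ k * / INR (fact k)))).
- intros k; change (Rabs (INR k ^ i * bessel_coef alpha k) <=
    / Rmin 1 (alpha + 1) * ((2 ^ i) ^ k * / INR (fact k))).
  rewrite Rabs_mult, Rabs_right by (apply Rle_ge, pow_le, pos_INR).
  apply Rle_trans with ((2 ^ i) ^ k *
    (/ Rmin 1 (alpha + 1) * (/ 4 ^ k * / INR (fact k)))).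
  + apply Rmult_le_compat; [apply pow_le, pos_INR | apply Rabs_pos | |
      now apply bessel_coef_bound].
    rewrite <- pow_mult, Nat.mul_comm, pow_mult. apply pow_incr.
    pose proof (INR_S_le_pow2 k); pose proof (pos_INR k); lra.
  + assert (Hm : 0 < / Rmin 1 (alpha + 1)) by (apply Rinv_0_lt_compat, Rmin_pos; lra).
    assert (Hf := Rinv_0_lt_compat _ (INR_fact_lt_0 k)).
    assert (H4 : 0 < / 4 ^ k <= 1).
    { split; [apply Rinv_0_lt_compat, pow_lt; lra|].
      rewrite <- Rinv_1; apply Rinv_le_contravar; [lra|]. apply pow_R1_Rle; lra. }
    assert (H2 : 0 < (2 ^ i) ^ k) by (apply pow_lt, pow_lt; lra).
    set (p := (2 ^ i) ^ k) in *. set (m := / Rmin 1 (alpha + 1)) in *.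
    set (q := / 4 ^ k) in *. set (f := / INR (fact k)) in *.
    assert (0 < p * m * f) by (repeat apply Rmult_lt_0_compat; lra). nra.
- apply (ex_series_scal (V := R_NormedModule)). eexists; apply exp_series.
Qed.

(** The ratio of the [k]-th terms of the polynomial at [sin (1 / (2 * N)) ^ 2]
    and of the Bessel series, with [x = (2 * N * sin (1 / (2 * N))) ^ 2]. The
    product form rests on
    [(k - n) * (n + k + alpha + beta + 1) = (k + s) ^ 2 - N ^ 2]. *)
Fixpoint damping (s N x : R) (k : nat) : R :=
  match k with
  | O => 1
  | S j => damping s N x j * ((1 - ((INR j + s) / N) ^ 2) * x)
  end.

Lemma hyp_coef_damping alpha beta n y k : -1 < alpha -> 0 < jacobi_N alpha beta n ->
  hyp_coef alpha beta n k * y ^ k = bessel_coef alpha k *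
    damping ((alpha + beta + 1) / 2) (jacobi_N alpha beta n)
      (4 * jacobi_N alpha beta n ^ 2 * y) k.
Proof.
intros Ha HN; induction k as [|k IH].
- unfold hyp_coef, bessel_coef; simpl; field.
- unfold hyp_coef, bessel_coef in *.
  assert (Hp := pochhammer_pos (alpha + 1) k ltac:(lra)).
  assert (Hf := INR_fact_lt_0 k).
  assert (Hk := pos_INR k).
  assert (H4 := pow_lt 4 k ltac:(lra)).
  set (N := jacobi_N alpha beta n) in *.
  set (P := pochhammer (- INR n) k * pochhammer (alpha + beta + INR n + 1) k) in *.
  set (s := (alpha + beta + 1) / 2) in *.
  assert (HP : pochhammer (- INR n) (S k) * pochhammer (alpha + beta + INR n + 1) (S k) =
    P * ((INR k + s) ^ 2 - N ^ 2)) by (unfold P, N, jacobi_N, s; simpl; field).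
  rewrite HP, fact_simpl, mult_INR, S_INR; simpl pochhammer; simpl pow; simpl damping.
  set (Q := damping s N (4 * (N * (N * 1)) * y) k) in *.
  transitivity (P / (pochhammer (alpha + 1) k * INR (fact k)) * y ^ k *
   ((INR k + s) ^ 2 - N ^ 2) * y / ((alpha + 1 + INR k) * (INR k + 1))).
  { field; lra. }
  rewrite IH. simpl pow. fold Q. field; lra.
Qed.

(** Every factor lies in [[0, 1]] up to [k = n]; the factor for [k = n] is 0. The
    defects [1 - factor] are added up. *)
Lemma damping_bounds s n x eps k : 0 <= x <= 1 -> 0 < INR n + s -> -1 < 2 * s ->
  1 - x <= eps ->
  0 <= damping s (INR n + s) x k <= 1 /\
  ((n < k)%nat -> damping s (INR n + s) x k = 0) /\
  1 - damping s (INR n + s) x k <= INR k * (((Rabs s + INR k) / (INR n + s)) ^ 2 + eps).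
Proof.
intros Hx HN Hs He; set (N := INR n + s) in *.
induction k as [|k [I1 [I2 I3]]]; [simpl; repeat split; (lra || lia)|].
assert (Hi : 0 < / N) by now apply Rinv_0_lt_compat.
assert (Hk := pos_INR k).
assert (Hmono : INR k * (((Rabs s + INR k) / N) ^ 2 + eps) +
   (((Rabs s + INR k) / N) ^ 2 + eps) <=
   INR (S k) * (((Rabs s + INR (S k)) / N) ^ 2 + eps)).
{ rewrite S_INR.
  replace (INR k * (((Rabs s + INR k) / N) ^ 2 + eps) + (((Rabs s + INR k) / N) ^ 2 + eps))
    with ((INR k + 1) * (((Rabs s + INR k) / N) ^ 2 + eps)) by ring.
  apply Rmult_le_compat_l; [lra|]. apply Rplus_le_compat_r, pow_incr.
  pose proof (Rabs_pos s). split.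
  - apply Rmult_le_pos; lra.
  - apply Rmult_le_compat_r; lra. }
assert (He0 : 0 <= eps) by lra.
change (damping s N x (S k)) with
  (damping s N x k * ((1 - ((INR k + s) / N) ^ 2) * x)).
set (d := damping s N x k) in *.
destruct (Nat.lt_ge_cases n k) as [L|L].
- rewrite (I2 L) in *. rewrite Rmult_0_l. repeat split; try lra.
  pose proof (pow2_ge_0 ((Rabs s + INR k) / N)). lra.
- set (e := ((INR k + s) / N) ^ 2) in *.
  assert (Ee : e <= ((Rabs s + INR k) / N) ^ 2).
  { unfold e; rewrite <- (pow2_abs ((INR k + s) / N)).
    apply pow_incr; split; [apply Rabs_pos|].
    unfold Rdiv; rewrite Rabs_mult, (Rabs_right (/ N)) by lra.
    apply Rmult_le_compat_r; [lra|].
    pose proof (Rabs_triang (INR k) s). rewrite (Rabs_right (INR k)) in H by lra. lra. }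
  assert (E1 : 0 <= e <= 1).
  { split; [apply pow2_ge_0|].
    unfold e; rewrite <- (pow2_abs ((INR k + s) / N)). replace 1 with (1 ^ 2) by ring.
    apply pow_incr; split; [apply Rabs_pos|].
    unfold Rdiv; rewrite Rabs_mult, (Rabs_right (/ N)) by lra.
    apply (Rmult_le_reg_r N); [lra|]. rewrite Rmult_assoc, Rinv_l, Rmult_1_l, Rmult_1_r by lra.
    apply Rabs_le. destruct (Nat.eq_dec n k) as [->|Enk].
    - unfold N in *; lra.
    - assert (INR k + 1 <= INR n) by (rewrite <- S_INR; apply le_INR; lia).
      unfold N in *; lra. }
  assert (F : 0 <= (1 - e) * x <= 1) by nra.
  assert (F1 : 1 - (1 - e) * x <= e + eps)
    by (assert (0 <= e * (1 - x)) by (apply Rmult_le_pos; lra); lra).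
  repeat split.
  + apply Rmult_le_pos; lra.
  + nra.
  + intros L'. assert (n = k) as <- by lia.
    replace e with 1; [ring|]. unfold e. fold N. field. lra.
  + assert (0 <= (1 - d) * (1 - (1 - e) * x)) by (apply Rmult_le_pos; lra).
    lra.
Qed.

Lemma approx_N alpha beta : approx (fun n => jacobi_N alpha beta n / INR n) 1.
Proof.
exists (Rabs ((alpha + beta + 1) / 2)).
generalize eventually_pos; apply filter_imp; intros n Hn.
unfold jacobi_N.
replace ((INR n + (alpha + beta + 1) / 2) / INR n - 1) with
  ((alpha + beta + 1) / 2 * / INR n) by (field; lra).
rewrite Rabs_mult, (Rabs_right (/ INR n)); [lra|].
apply Rle_ge; left; now apply Rinv_0_lt_compat.
Qed.

Lemma eventually_N_ge alpha beta A : eventually (fun n => A <= jacobi_N alpha beta n).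
Proof.
generalize (eventually_ge (A - (alpha + beta + 1) / 2)); apply filter_imp.
unfold jacobi_N; intros n H; lra.
Qed.

Lemma bigO_inv_N alpha beta : bigO (fun n => / INR n) (fun n => / jacobi_N alpha beta n).
Proof.
exists 2.
generalize (filter_and _ _ (eventually_N_ge alpha beta 1)
  (eventually_ge (2 * Rabs ((alpha + beta + 1) / 2) + 1))); apply filter_imp; intros n [H1 H2].
unfold jacobi_N in *.
pose proof (Rle_abs (- ((alpha + beta + 1) / 2))) as A; rewrite Rabs_Ropp in A.
pose proof (Rabs_pos ((alpha + beta + 1) / 2)).
rewrite Rabs_right by (apply Rle_ge; left; apply Rinv_0_lt_compat; lra).
replace (2 * / INR n) with (/ (INR n / 2)) by (field; lra).
apply Rinv_le_contravar; lra.
Qed.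

Lemma sinc_sq_bounds N : 1 <= N ->
  0 <= 4 * N ^ 2 * sin (/ N / 2) ^ 2 <= 1 /\
  1 - 4 * N ^ 2 * sin (/ N / 2) ^ 2 <= / N ^ 2.
Proof.
intros HN; set (t := / N / 2).
assert (Hi : 0 < / N <= 1) by now apply Rinv_unit_interval.
assert (Ht : 0 < t <= 1 / 2) by (unfold t; lra).
assert (E : 4 * N ^ 2 * sin t ^ 2 = (sin t / t) ^ 2) by (unfold t; field; lra).
assert (Ei : / N ^ 2 = 4 * t ^ 2) by (unfold t; field; lra).
rewrite E, Ei.
pose proof (sin_lt_x t ltac:(lra)) as U.
pose proof (sin_ge_cubic t ltac:(lra)) as L.
assert (L' : 1 - t ^ 2 / 6 <= sin t / t).
{ apply (Rmult_le_reg_r t); [lra|]. unfold Rdiv at 2; rewrite Rmult_assoc, Rinv_l by lra. lra. }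
assert (U' : sin t / t <= 1).
{ apply (Rmult_le_reg_r t); [lra|]. unfold Rdiv; rewrite Rmult_assoc, Rinv_l by lra. lra. }
assert (0 <= t ^ 2 <= 1 / 4) by nra.
split; [split; nra|]. nra.
Qed.

(** The Mehler--Heine limit at [z = 1], with a rate. The limit depends on
    [alpha] alone. *)
Lemma approx_moment i alpha beta : -1 < alpha -> -1 < beta -> (i <= 1)%nat ->
  approx (fun n => moment i alpha beta n (sin (/ jacobi_N alpha beta n / 2) ^ 2))
    (bessel_moment i alpha).
Proof.
intros Ha Hb Hi.
set (s := (alpha + beta + 1) / 2).
set (S0 := (Rabs s + 1) ^ 2 + 1).
set (m := Rmin 1 (alpha + 1)).
assert (Hm : 0 < / m) by (apply Rinv_0_lt_compat, Rmin_pos; lra).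
assert (HS : 1 <= S0) by (unfold S0; pose proof (pow2_ge_0 (Rabs s + 1)); lra).
apply (bigO_le _ _ (fun n => (S0 * / m) * exp 4 * / jacobi_N alpha beta n)).
2:{ apply bigO_bounded_l; [apply bigO_const | apply bigO_inv_N]. }
generalize (eventually_N_ge alpha beta 1); apply filter_imp; intros n HN.
set (N := jacobi_N alpha beta n) in *.
assert (Hi0 : 0 < / N <= 1) by now apply Rinv_unit_interval.
destruct (sinc_sq_bounds N HN) as [Hx Hx'].
set (x := 4 * N ^ 2 * sin (/ N / 2) ^ 2) in *.
assert (EN : N = INR n + s) by reflexivity.
assert (Hd := fun k => damping_bounds s n x (/ N ^ 2) k Hx ltac:(lra)
   ltac:(unfold s; lra) Hx').
rewrite <- EN in Hd.
rewrite (Rabs_right (_ * / N)).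
2:{ pose proof (exp_pos 4); apply Rle_ge; repeat apply Rmult_le_pos; lra. }
apply Rle_trans with (S0 * / m * exp 4 * (/ N ^ 2)).
2:{ apply Rmult_le_compat_l.
    - pose proof (exp_pos 4); repeat apply Rmult_le_pos; lra.
    - replace (/ N ^ 2) with (/ N * / N) by (field; lra). nra. }
replace (moment i alpha beta n (sin (/ N / 2) ^ 2)) with
  (sum_f_R0 (fun k => INR k ^ i * bessel_coef alpha k * damping s N x k) n).
2:{ unfold moment; apply sum_eq; intros k _.
    rewrite (Rmult_assoc (INR k ^ i) (hyp_coef _ _ _ _)),
      (hyp_coef_damping alpha beta n _ k Ha) by (fold N; lra). unfold x, s; fold N; ring. }
unfold bessel_moment.
apply (sum_perturb (fun k => INR k ^ i * bessel_coef alpha k)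
  (fun k => S0 * / m * (4 ^ k * / INR (fact k)))).
- now apply ex_series_bessel.
- left; apply Rinv_0_lt_compat, pow_lt; lra.
- intros k; apply (proj1 (proj2 (Hd k))).
- intros k. destruct (Hd k) as [D1 [_ D2]].
  rewrite (Rabs_minus_sym (damping _ _ _ _)), (Rabs_right (1 - _)) by lra.
  set (d := damping s N x k) in *.
  assert (Hk := pos_INR k). pose proof (INR_S_le_pow2 k) as Hk2.
  pose proof (Rabs_pos s) as Hsp.
  set (kk := INR k) in *. set (T := 2 ^ k) in *.
  (* [k ^ (i + 1) * ((|s| + k) ^ 2 + 1) <= S0 * 16 ^ k] *)
  assert (D3 : 1 - d <= kk * (S0 * T ^ 2) * / N ^ 2).
  { eapply Rle_trans; [exact D2|].
    replace (kk * (((Rabs s + kk) / N) ^ 2 + / N ^ 2)) with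
      (kk * ((Rabs s + kk) ^ 2 + 1) * / N ^ 2) by (field; lra).
    apply Rmult_le_compat_r; [left; apply Rinv_0_lt_compat, pow_lt; lra|].
    apply Rmult_le_compat_l; [lra|].
    apply Rle_trans with (((Rabs s + 1) * T) ^ 2 + T ^ 2); [|unfold S0; lra].
    apply Rplus_le_compat.
    - apply pow_incr; nra.
    - replace 1 with (1 ^ 2) at 1 by ring; apply pow_incr; lra. }
  assert (D4 : kk ^ i * kk <= T ^ 2).
  { destruct i as [|[|i]]; [| |lia]; simpl; nra. }
  rewrite Rabs_mult, Rabs_right by (apply Rle_ge, pow_le; lra).
  apply Rle_trans with (kk ^ i * (/ m * (/ 4 ^ k * / INR (fact k))) *
    (kk * (S0 * T ^ 2) * / N ^ 2)).
  { apply Rmult_le_compat; [|lra| |exact D3].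
    - apply Rmult_le_pos; [now apply pow_le | apply Rabs_pos].
    - apply Rmult_le_compat_l; [now apply pow_le | now apply bessel_coef_bound]. }
  assert (E4 : 4 ^ k = T ^ 2).
  { unfold T; rewrite <- pow_mult, Nat.mul_comm, pow_mult; f_equal; lra. }
  rewrite E4.
  assert (HT : 0 < T) by lra.
  assert (Hf := Rinv_0_lt_compat _ (INR_fact_lt_0 k)).
  assert (HN2 : 0 < / N ^ 2) by (apply Rinv_0_lt_compat, pow_lt; lra).
  replace (kk ^ i * (/ m * (/ T ^ 2 * / INR (fact k))) * (kk * (S0 * T ^ 2) * / N ^ 2))
    with (S0 * / m * / INR (fact k) * / N ^ 2 * (kk ^ i * kk))
    by (field; repeat split; try lra; unfold m; pose proof (Rmin_pos 1 (alpha + 1)); try lra;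
        apply INR_fact_neq_0).
  replace (S0 * / m * (T ^ 2 * / INR (fact k)) * / N ^ 2) with
    (S0 * / m * / INR (fact k) * / N ^ 2 * T ^ 2) by ring.
  apply Rmult_le_compat_l; [|exact D4].
  repeat apply Rmult_le_pos; lra.
- intros M.
  replace (sum_f_R0 (fun k => S0 * / m * (4 ^ k * / INR (fact k))) M) with
    (S0 * / m * sum_f_R0 (fun k => 4 ^ k * / INR (fact k)) M).
  + apply Rmult_le_compat_l; [apply Rmult_le_pos; lra|]. apply exp_partial_sums; lra.
  + rewrite scal_sum; apply sum_eq; intros; ring.
Qed.

(** * The equation on the scale [z = N x] *)

(** The factor [(2 * N) ^ (alpha + 1/2)] compensates the prefactor
    [sin (x / 2) ^ (alpha + 1/2)], so that the data at [z = 1] converge as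
    [n] grows. *)
Definition scaled (alpha beta : R) (n : nat) (z : R) : R :=
  Rpower (2 * jacobi_N alpha beta n) (alpha + 1 / 2)
  * liouville alpha beta n (z / jacobi_N alpha beta n).

Definition scaled' (alpha beta : R) (n : nat) (z : R) : R :=
  Rpower (2 * jacobi_N alpha beta n) (alpha + 1 / 2)
  * (liouville' alpha beta n (z / jacobi_N alpha beta n) / jacobi_N alpha beta n).

(** What is left of the potential after removal of its singular part at 0. *)
Definition scaled_perturbation (alpha beta : R) (n : nat) (z : R) : R :=
  (potential alpha beta (z / jacobi_N alpha beta n)
   - (1 / 4 - alpha ^ 2) / (z / jacobi_N alpha beta n) ^ 2) / jacobi_N alpha beta n ^ 2.

Lemma scaled_domain N z : 0 < N -> 0 < z < N * PI -> 0 < z / N < PI.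
Proof.
intros HN Hz; split.
- apply Rdiv_lt_0_compat; lra.
- apply (Rmult_lt_reg_r N); [lra|]. unfold Rdiv; rewrite Rmult_assoc, Rinv_l by lra. lra.
Qed.

Lemma is_derive_scaled alpha beta n z : 0 < jacobi_N alpha beta n ->
  0 < z < jacobi_N alpha beta n * PI ->
  is_derive (scaled alpha beta n) z (scaled' alpha beta n z).
Proof.
intros HN Hz; unfold scaled, scaled'.
apply is_derive_scal.
evar_last.
- apply (is_derive_comp (liouville alpha beta n) (fun t => t / jacobi_N alpha beta n)).
  + apply is_derive_liouville, scaled_domain; lra.
  + auto_derive; [exact I|reflexivity].
- unfold scal; simpl; unfold mult; simpl. unfold Rdiv; ring.
Qed.

Lemma is_derive_scaled' alpha beta n z : -1 < alpha -> 0 < jacobi_N alpha beta n ->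
  0 < z < jacobi_N alpha beta n * PI ->
  is_derive (scaled' alpha beta n) z
    (- (1 + (1 / 4 - alpha ^ 2) / z ^ 2 + scaled_perturbation alpha beta n z)
     * scaled alpha beta n z).
Proof.
intros Ha HN Hz; unfold scaled, scaled', scaled_perturbation.
set (N := jacobi_N alpha beta n) in *.
evar_last.
- apply is_derive_scal.
  apply (is_derive_ext (fun t => / N * liouville' alpha beta n (t / N)));
    [intros t; unfold Rdiv; apply Rmult_comm|].
  apply is_derive_scal.
  apply (is_derive_comp (liouville' alpha beta n) (fun t => t / N)).
  + apply (is_derive_liouville' alpha beta n (z / N) Ha), scaled_domain; lra.
  + auto_derive; [exact I|reflexivity].
- unfold scal; simpl; unfold mult; simpl. fold N. field; lra.
Qed.

(** The two double poles at [x = 0] cancel. *)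
Lemma Rinv_sin_sq_bound x : 0 < x < PI ->
  Rabs (/ (4 * sin (x / 2) ^ 2) - / x ^ 2) <= 1.
Proof.
intros Hx; set (u := x / 2).
assert (Hu : 0 < u < 2) by (unfold u; pose proof PI_4; lra).
pose proof (sin_lt_x u ltac:(lra)) as U.
pose proof (sin_ge_cubic u ltac:(lra)) as L.
set (s := sin u) in *.
assert (Ls : u / 3 <= s) by nra.
replace (/ x ^ 2) with (/ (4 * u ^ 2)) by (unfold u; field; lra).
replace (/ (4 * s ^ 2) - / (4 * u ^ 2)) with ((u ^ 2 - s ^ 2) / (4 * s ^ 2 * u ^ 2))
  by (field; lra).
assert (Hden : 0 < 4 * s ^ 2 * u ^ 2) by (repeat apply Rmult_lt_0_compat; lra || (apply pow_lt; lra)).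
assert (Num : u ^ 2 - s ^ 2 <= u ^ 4 / 3).
{ replace (u ^ 2 - s ^ 2) with ((u - s) * (u + s)) by ring.
  apply Rle_trans with (u ^ 3 / 6 * (2 * u)); [|lra].
  apply Rmult_le_compat; lra. }
assert (Den : u ^ 2 * u ^ 2 / 9 * 4 <= 4 * s ^ 2 * u ^ 2).
{ assert (u ^ 2 / 9 <= s ^ 2) by (replace (u ^ 2 / 9) with ((u / 3) ^ 2) by field; apply pow_incr; lra).
  assert (0 < u ^ 2) by (apply pow_lt; lra). nra. }
assert (0 < u ^ 4) by (apply pow_lt; lra).
rewrite Rabs_right.
- apply (Rmult_le_reg_r (4 * s ^ 2 * u ^ 2)); [lra|].
  unfold Rdiv; rewrite Rmult_assoc, Rinv_l by lra. lra.
- apply Rle_ge; apply Rmult_le_pos; [|left; now apply Rinv_0_lt_compat]. nra.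
Qed.

Lemma potential_bound alpha beta x x1 : 0 < x <= x1 -> x1 < PI ->
  Rabs (potential alpha beta x - (1 / 4 - alpha ^ 2) / x ^ 2) <=
  Rabs (1 / 4 - alpha ^ 2) + Rabs (1 / 4 - beta ^ 2) / (4 * cos (x1 / 2) ^ 2).
Proof.
intros Hx Hx1; unfold potential.
replace (_ + _ - _) with ((1 / 4 - alpha ^ 2) * (/ (4 * sin (x / 2) ^ 2) - / x ^ 2)
  + (1 / 4 - beta ^ 2) / (4 * cos (x / 2) ^ 2)) by (unfold Rdiv; ring).
eapply Rle_trans; [apply Rabs_triang|]. apply Rplus_le_compat.
- rewrite Rabs_mult.
  pose proof (Rinv_sin_sq_bound x ltac:(lra)). pose proof (Rabs_pos (1 / 4 - alpha ^ 2)). nra.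
- unfold Rdiv at 1; rewrite Rabs_mult. unfold Rdiv at 3.
  apply Rmult_le_compat_l; [apply Rabs_pos|].
  assert (0 < cos (x1 / 2)) by (apply cos_gt_0; lra).
  assert (cos (x1 / 2) <= cos (x / 2)) by (apply cos_decr_1; lra).
  assert (cos (x1 / 2) ^ 2 <= cos (x / 2) ^ 2) by (apply pow_incr; lra).
  assert (0 < cos (x1 / 2) ^ 2) by (apply pow_lt; lra).
  rewrite Rabs_right by (apply Rle_ge; left; apply Rinv_0_lt_compat; lra).
  apply Rinv_le_contravar; lra.
Qed.

Lemma approx_inv_N alpha beta : approx (fun n => / jacobi_N alpha beta n / 2) 0.
Proof.
apply (bigO_le _ _ (fun n => / 2 * / jacobi_N alpha beta n)).
- apply filter_forall; intros n. rewrite Rminus_0_r. unfold Rdiv; rewrite Rmult_comm; lra.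
- apply bigO_bounded_l; [apply bigO_const | apply bigO_inv_N].
Qed.

Lemma approx_sinc alpha beta :
  approx (fun n => 2 * jacobi_N alpha beta n * sin (/ jacobi_N alpha beta n / 2)) 1.
Proof.
apply (bigO_le _ _ (fun n => / jacobi_N alpha beta n)); [|apply bigO_inv_N].
generalize (eventually_N_ge alpha beta 1); apply filter_imp; intros n HN.
set (N := jacobi_N alpha beta n) in *.
destruct (sinc_sq_bounds N HN) as [H1 H2].
assert (Hi : 0 < / N <= 1) by now apply Rinv_unit_interval.
assert (Hs : 0 < sin (/ N / 2)) by (apply sin_gt_0; pose proof PI2_1; unfold PI2 in *; lra).
set (y := 2 * N * sin (/ N / 2)).
assert (Hy : 0 < y) by (unfold y; repeat apply Rmult_lt_0_compat; lra).
assert (Ey : 4 * N ^ 2 * sin (/ N / 2) ^ 2 = y ^ 2) by (unfold y; ring).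
rewrite Ey in *.
rewrite (Rabs_right (/ N)) by lra.
assert (/ N ^ 2 <= / N) by (replace (/ N ^ 2) with (/ N * / N) by (field; lra); nra).
rewrite Rabs_left1 by nra. nra.
Qed.

Definition bessel_slope (alpha : R) : R :=
  2 * (bessel_moment 1 alpha + (alpha + 1 / 2) / 2 * bessel_moment 0 alpha).

Lemma approx_scaled_prefactor alpha beta :
  approx (fun n => Rpower (2 * jacobi_N alpha beta n) (alpha + 1 / 2) *
    (Rpower (sin (/ jacobi_N alpha beta n / 2)) (alpha + 1 / 2) *
     Rpower (cos (/ jacobi_N alpha beta n / 2)) (beta + 1 / 2))) 1.
Proof.
replace 1 with (Rpower 1 (alpha + 1 / 2) * Rpower (cos 0) (beta + 1 / 2)) at 1
  by (rewrite cos_0; unfold Rpower; rewrite ln_1, !Rmult_0_r, exp_0; ring).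
apply (approx_ext_loc (fun n =>
  Rpower (2 * jacobi_N alpha beta n * sin (/ jacobi_N alpha beta n / 2)) (alpha + 1 / 2) *
  Rpower (cos (/ jacobi_N alpha beta n / 2)) (beta + 1 / 2))).
- generalize (eventually_N_ge alpha beta 1); apply filter_imp; intros n HN.
  assert (Hi : 0 < / jacobi_N alpha beta n <= 1) by now apply Rinv_unit_interval.
  rewrite <- Rpower_mult_distr; [ring|lra|].
  apply sin_gt_0; pose proof PI2_1; unfold PI2 in *; lra.
- apply approx_mult.
  + apply approx_Rpower; [lra | apply approx_sinc].
  + apply approx_Rpower; [rewrite cos_0; lra|].
    apply (approx_comp cos); [auto_derive; exact I | apply approx_inv_N].
Qed.

Lemma approx_scaled_at_1 alpha beta : -1 < alpha -> -1 < beta ->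
  approx (fun n => scaled alpha beta n 1) (bessel_moment 0 alpha).
Proof.
intros Ha Hb.
apply (approx_ext (fun n => Rpower (2 * jacobi_N alpha beta n) (alpha + 1 / 2) *
    (Rpower (sin (/ jacobi_N alpha beta n / 2)) (alpha + 1 / 2) *
     Rpower (cos (/ jacobi_N alpha beta n / 2)) (beta + 1 / 2)) *
    moment 0 alpha beta n (sin (/ jacobi_N alpha beta n / 2) ^ 2))).
- intros n; unfold scaled, liouville.
  replace (1 / jacobi_N alpha beta n) with (/ jacobi_N alpha beta n) by (unfold Rdiv; ring).
  ring.
- rewrite <- (Rmult_1_l (bessel_moment _ _)).
  apply approx_mult; [apply approx_scaled_prefactor | apply approx_moment; auto].
Qed.

Lemma approx_scaled'_at_1 alpha beta : -1 < alpha -> -1 < beta ->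
  approx (fun n => scaled' alpha beta n 1) (bessel_slope alpha).
Proof.
intros Ha Hb.
pose (N := jacobi_N alpha beta).
pose (t := fun n => / N n / 2).
pose (m0 := fun n => moment 0 alpha beta n (sin (t n) ^ 2)).
pose (m1 := fun n => moment 1 alpha beta n (sin (t n) ^ 2)).
assert (Hcos : approx (fun n => cos (t n)) 1).
{ rewrite <- cos_0; apply (approx_comp cos); [auto_derive; exact I | apply approx_inv_N]. }
assert (Hsin : approx (fun n => sin (t n)) 0).
{ rewrite <- sin_0; apply (approx_comp sin); [auto_derive; exact I | apply approx_inv_N]. }
assert (Hm0 : approx m0 (bessel_moment 0 alpha)) by (apply approx_moment; auto).
assert (Hm1 : approx m1 (bessel_moment 1 alpha)) by (apply approx_moment; auto).
apply (approx_ext_loc (fun n => Rpower (2 * N n) (alpha + 1 / 2) *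
    (Rpower (sin (t n)) (alpha + 1 / 2) * Rpower (cos (t n)) (beta + 1 / 2)) *
    (2 * (cos (t n) * / (2 * N n * sin (t n))) * (m1 n + (alpha + 1 / 2) / 2 * m0 n)
     + - ((beta + 1 / 2) / 2 * (sin (t n) * / cos (t n)) * (2 * t n) * m0 n)))).
- generalize (eventually_N_ge alpha beta 1); apply filter_imp; intros n HN.
  fold (N n) in HN.
  assert (Hi : 0 < / N n <= 1) by now apply Rinv_unit_interval.
  assert (Hs : 0 < sin (t n)) by (apply sin_gt_0; pose proof PI2_1; unfold PI2, t in *; lra).
  assert (Hc : 0 < cos (t n)) by (apply cos_gt_0; pose proof PI2_1; unfold PI2, t in *; lra).
  unfold scaled', liouville'; fold (N n).
  replace (1 / N n / 2) with (t n) by (unfold t, Rdiv; ring).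
  fold (m0 n) (m1 n). unfold t at 7. field; lra.
- unfold bessel_slope. rewrite <- (Rmult_1_l (2 * _)).
  apply approx_mult; [apply approx_scaled_prefactor|].
  replace (2 * (bessel_moment 1 alpha + (alpha + 1 / 2) / 2 * bessel_moment 0 alpha)) with
   (2 * (1 * / 1) * (bessel_moment 1 alpha + (alpha + 1 / 2) / 2 * bessel_moment 0 alpha)
    + - ((beta + 1 / 2) / 2 * (0 * / 1) * (2 * 0) * bessel_moment 0 alpha)) by field.
  pose proof (approx_inv _ 1 R1_neq_R0 (approx_sinc alpha beta)) as Hsc.
  repeat first [exact Hm0 | exact Hm1 | exact Hcos | exact Hsin | exact Hsc
    | apply approx_inv_N | apply approx_plus | apply approx_opp | apply approx_mult
    | apply (approx_inv (fun n => cos (t n)) 1 R1_neq_R0) | apply approx_const].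
Qed.

(** * Comparison across values of [beta] *)

Lemma scaled_perturbation_bound alpha beta n z x1 :
  0 < jacobi_N alpha beta n -> 0 < z <= jacobi_N alpha beta n * x1 -> x1 < PI ->
  Rabs (scaled_perturbation alpha beta n z) <=
  (Rabs (1 / 4 - alpha ^ 2) + Rabs (1 / 4 - beta ^ 2) / (4 * cos (x1 / 2) ^ 2))
  / jacobi_N alpha beta n ^ 2.
Proof.
intros HN Hz Hx1; unfold scaled_perturbation, Rdiv at 1.
assert (0 < / jacobi_N alpha beta n ^ 2) by (apply Rinv_0_lt_compat, pow_lt; lra).
rewrite Rabs_mult, (Rabs_right (/ _)) by lra.
apply Rmult_le_compat_r; [lra|].
apply potential_bound; [split|]; [| |exact Hx1].
- apply Rdiv_lt_0_compat; lra.
- apply (Rmult_le_reg_r (jacobi_N alpha beta n)); [lra|].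
  unfold Rdiv; rewrite Rmult_assoc, Rinv_l by lra. lra.
Qed.

(** On the scale [z = N * theta] the exponent [beta] only enters the [O(N ^ -2)]
    part of the potential and, at [z = 1], the [O(1 / N)] part of the data. *)
Lemma scaled_compare alpha beta1 beta2 theta :
  -1 < alpha -> -1 < beta1 -> -1 < beta2 -> 0 < theta < PI ->
  bigO (fun n => / INR n) (fun n =>
    scaled alpha beta1 n (jacobi_N alpha beta1 n * theta) -
    scaled alpha beta2 n (jacobi_N alpha beta1 n * theta)) /\
  bigO (fun n => / INR n) (fun n =>
    scaled' alpha beta1 n (jacobi_N alpha beta1 n * theta) -
    scaled' alpha beta2 n (jacobi_N alpha beta1 n * theta)).
Proof.
intros Ha Hb1 Hb2 Ht.
set (N1 := jacobi_N alpha beta1). set (N2 := jacobi_N alpha beta2).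
set (x1 := (theta + PI) / 2).
assert (Hx1 : theta < x1 < PI) by (unfold x1; lra).
set (nu := 1 / 4 - alpha ^ 2).
set (k1 := Rabs nu + Rabs (1 / 4 - beta1 ^ 2) / (4 * cos (x1 / 2) ^ 2)).
set (k2 := Rabs nu + Rabs (1 / 4 - beta2 ^ 2) / (4 * cos (x1 / 2) ^ 2)).
assert (Hcos : 0 < 4 * cos (x1 / 2) ^ 2).
{ assert (0 < cos (x1 / 2)) by (apply cos_gt_0; lra).
  assert (0 < cos (x1 / 2) ^ 2) by (apply pow_lt; lra). lra. }
assert (Hk : 0 <= k1 /\ 0 <= k2).
{ split; apply Rplus_le_le_0_compat; try apply Rabs_pos;
  apply Rmult_le_pos; try apply Rabs_pos; left; now apply Rinv_0_lt_compat. }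
(* The factor 4 allows for [N1 <= 2 * N2] when the bound for [beta2] is
   expressed in [N1]. *)
set (c := k1 + 4 * k2).
set (e0 := fun n => (scaled alpha beta1 n 1 - scaled alpha beta2 n 1) ^ 2 +
  (scaled' alpha beta1 n 1 - scaled' alpha beta2 n 1) ^ 2).
set (K := (Rabs (bessel_moment 0 alpha) + 1) ^ 2 + (Rabs (bessel_slope alpha) + 1) ^ 2).
set (B := exp (Rabs nu / 1 + (c + 2 * c * 0) * theta) * K + 1).
assert (HB : 0 <= B).
{ unfold B, K; pose proof (exp_pos (Rabs nu / 1 + (c + 2 * c * 0) * theta)).
  pose proof (pow2_ge_0 (Rabs (bessel_moment 0 alpha) + 1)).
  pose proof (pow2_ge_0 (Rabs (bessel_slope alpha) + 1)). nra. }
set (P := exp (Rabs nu / 1 + (c + 2 * c * B) * theta)).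
set (E := fun n => P * (e0 n + 2 * c * B * theta / N1 n ^ 2)).
assert (He0 : bigO (fun n => / INR n * / INR n) e0).
{ assert (D1 : bigO (fun n => / INR n) (fun n => scaled alpha beta1 n 1 - scaled alpha beta2 n 1)).
  { apply (bigO_ext_loc _ (fun n => (scaled alpha beta1 n 1 - bessel_moment 0 alpha)
      + - (scaled alpha beta2 n 1 - bessel_moment 0 alpha))).
    - apply filter_forall; intros n; ring.
    - apply bigO_plus; [|apply bigO_opp]; now apply approx_scaled_at_1. }
  assert (D2 : bigO (fun n => / INR n) (fun n => scaled' alpha beta1 n 1 - scaled' alpha beta2 n 1)).
  { apply (bigO_ext_loc _ (fun n => (scaled' alpha beta1 n 1 - bessel_slope alpha)
      + - (scaled' alpha beta2 n 1 - bessel_slope alpha))).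
    - apply filter_forall; intros n; ring.
    - apply bigO_plus; [|apply bigO_opp]; now apply approx_scaled'_at_1. }
  apply bigO_plus.
  - apply (bigO_ext_loc _ _ _) with (2 := bigO_mult _ _ _ _ D1 D1).
    apply filter_forall; intros n; ring.
  - apply (bigO_ext_loc _ _ _) with (2 := bigO_mult _ _ _ _ D2 D2).
    apply filter_forall; intros n; ring. }
assert (HE : bigO (fun n => / INR n * / INR n) E).
{ unfold E; apply bigO_bounded_l; [apply bigO_const|].
  apply bigO_plus; [exact He0|].
  apply (bigO_ext_loc _ (fun n => (2 * c * B * theta) * (/ N1 n * / N1 n))).
  - generalize (eventually_N_ge alpha beta1 1); apply filter_imp; intros n HN.
    fold (N1 n) in HN; field; lra.
  - apply bigO_bounded_l; [apply bigO_const|].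
    apply bigO_mult; apply bigO_inv_N. }
assert (Main : eventually (fun n =>
  (scaled alpha beta1 n (N1 n * theta) - scaled alpha beta2 n (N1 n * theta)) ^ 2 +
  (scaled' alpha beta1 n (N1 n * theta) - scaled' alpha beta2 n (N1 n * theta)) ^ 2
  <= E n)).
{ generalize (filter_and _ _ (filter_and _ _
    (approx_near _ _ 1 Rlt_0_1 (approx_scaled_at_1 alpha beta2 Ha Hb2))
    (approx_near _ _ 1 Rlt_0_1 (approx_scaled'_at_1 alpha beta2 Ha Hb2)))
   (eventually_N_ge alpha beta1
      (1 + / theta + 2 * Rabs ((beta2 - beta1) / 2) + Rabs ((beta2 - beta1) / 2) * x1 / (x1 - theta)))).
  apply filter_imp; intros n [[V1 V2] HN].
  fold (N1 n) in HN.
  set (d := (beta2 - beta1) / 2) in *.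
  assert (EN : N2 n = N1 n + d) by (unfold N2, N1, jacobi_N, d; field).
  assert (Hti : 0 < / theta) by (apply Rinv_0_lt_compat; lra).
  assert (Hxi : 0 < / (x1 - theta)) by (apply Rinv_0_lt_compat; lra).
  assert (Hd0 := Rabs_pos d).
  assert (Hdx : 0 <= Rabs d * x1 / (x1 - theta))
    by (apply Rmult_le_pos; [apply Rmult_le_pos; lra | lra]).
  assert (Hd : - Rabs d <= d <= Rabs d)
    by (pose proof (Rle_abs d); pose proof (Rle_abs (- d)); rewrite Rabs_Ropp in *; lra).
  assert (HN1 : 1 <= N1 n) by lra.
  assert (HN12 : N1 n <= 2 * N2 n) by lra.
  assert (HNt : 1 <= N1 n * theta).
  { apply Rle_trans with (/ theta * theta); [rewrite Rinv_l; lra|].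
    apply Rmult_le_compat_r; lra. }
  assert (HNx : N1 n * theta <= N2 n * x1).
  { assert (Rabs d * x1 <= N1 n * (x1 - theta)).
    { apply Rle_trans with (Rabs d * x1 / (x1 - theta) * (x1 - theta)).
      - right; field; lra.
      - apply Rmult_le_compat_r; lra. }
    rewrite EN; nra. }
  assert (HNP : N2 n * x1 < N2 n * PI) by (apply Rmult_lt_compat_l; lra).
  assert (HNP1 : N1 n * x1 < N1 n * PI) by (apply Rmult_lt_compat_l; lra).
  assert (HNx1 : N1 n * theta <= N1 n * x1) by (apply Rmult_le_compat_l; lra).
  assert (HM : 0 < / N1 n ^ 2) by (apply Rinv_0_lt_compat, pow_lt; lra).
  assert (Hrho1 : forall z, 1 <= z <= N1 n * theta ->
     Rabs (scaled_perturbation alpha beta1 n z) <= c / N1 n ^ 2).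
  { intros z Hz; eapply Rle_trans.
    - apply (scaled_perturbation_bound _ _ _ _ x1); fold (N1 n); lra.
    - fold (N1 n) nu k1; apply Rmult_le_compat_r; [lra|]. unfold c; lra. }
  assert (Hrho2 : forall z, 1 <= z <= N1 n * theta ->
     Rabs (scaled_perturbation alpha beta2 n z) <= c / N1 n ^ 2).
  { intros z Hz; eapply Rle_trans.
    - apply (scaled_perturbation_bound _ _ _ _ x1); fold (N2 n); lra.
    - fold (N2 n) nu k2. apply Rle_trans with (4 * k2 / N1 n ^ 2).
      + replace (4 * k2 / N1 n ^ 2) with (k2 * / (N1 n / 2) ^ 2) by (field; lra).
        apply Rmult_le_compat_l; [lra|]. apply Rinv_le_contravar.
        * apply pow_lt; lra.
        * apply pow_incr; lra.
      + apply Rmult_le_compat_r; [lra|]. unfold c; lra. }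
  assert (HF1 : forall z, 1 <= z <= N1 n * theta ->
     is_derive (scaled alpha beta1 n) z (scaled' alpha beta1 n z)).
  { intros z Hz; apply is_derive_scaled; fold (N1 n); lra. }
  assert (HF2 : forall z, 1 <= z <= N1 n * theta ->
     is_derive (scaled alpha beta2 n) z (scaled' alpha beta2 n z)).
  { intros z Hz; apply is_derive_scaled; fold (N2 n); lra. }
  assert (HG1 : forall z, 1 <= z <= N1 n * theta -> is_derive (scaled' alpha beta1 n) z
     (- (1 + nu / z ^ 2 + scaled_perturbation alpha beta1 n z) * scaled alpha beta1 n z)).
  { intros z Hz; apply is_derive_scaled'; fold (N1 n); lra. }
  assert (HG2 : forall z, 1 <= z <= N1 n * theta -> is_derive (scaled' alpha beta2 n) z
     (- (1 + nu / z ^ 2 + scaled_perturbation alpha beta2 n z) * scaled alpha beta2 n z)).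
  { intros z Hz; apply is_derive_scaled'; fold (N2 n); lra. }
  assert (Hc : 0 <= c) by (unfold c; lra).
  (* an a priori bound, by comparison with the zero solution *)
  assert (HB2 : forall z, 1 <= z <= N1 n * theta -> Rabs (scaled alpha beta2 n z) <= B).
  { intros z Hz.
    pose proof (oscillator_compare (scaled alpha beta2 n) (scaled' alpha beta2 n)
      (fun _ => 0) (fun _ => 0) (scaled_perturbation alpha beta2 n)
      (scaled_perturbation alpha beta2 n) nu c 0 (N1 n) theta 1 z) as Q.
    cbv beta in Q; rewrite !Rminus_0_r in Q.
    assert (Q' : scaled alpha beta2 n z ^ 2 + scaled' alpha beta2 n z ^ 2 <=
      exp (Rabs nu / 1 + (c + 2 * c * 0) * theta) * K).
    { eapply Rle_trans; [apply Q; try lra|].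
      - intros y Hy; apply HF2; lra.
      - intros y Hy; apply HG2; lra.
      - intros y Hy; apply is_derive_Reals, derivable_pt_lim_const.
      - intros y Hy; rewrite Rmult_0_r; apply is_derive_Reals, derivable_pt_lim_const.
      - intros y Hy; apply Hrho2; lra.
      - intros y Hy; apply Hrho2; lra.
      - intros y Hy; rewrite Rabs_R0; lra.
      - apply Rmult_le_compat_l; [left; apply exp_pos|].
        assert (W1 : Rabs (scaled alpha beta2 n 1) <= Rabs (bessel_moment 0 alpha) + 1).
        { replace (scaled alpha beta2 n 1) with
            (bessel_moment 0 alpha + (scaled alpha beta2 n 1 - bessel_moment 0 alpha)) by ring.
          eapply Rle_trans; [apply Rabs_triang|]; lra. }
        assert (W2 : Rabs (scaled' alpha beta2 n 1) <= Rabs (bessel_slope alpha) + 1).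
        { replace (scaled' alpha beta2 n 1) with
            (bessel_slope alpha + (scaled' alpha beta2 n 1 - bessel_slope alpha)) by ring.
          eapply Rle_trans; [apply Rabs_triang|]; lra. }
        replace (2 * c * 0 * theta / N1 n ^ 2) with 0 by (field; lra). rewrite Rplus_0_r.
        unfold K; apply Rplus_le_compat;
          [rewrite <- (pow2_abs (scaled _ _ _ _)) | rewrite <- (pow2_abs (scaled' _ _ _ _))];
          apply pow_incr; split; auto using Rabs_pos. }
    unfold B. pose proof (pow2_ge_0 (scaled' alpha beta2 n z)).
    rewrite <- pow2_abs in Q'. pose proof (Rabs_pos (scaled alpha beta2 n z)). nra. }
  pose proof (oscillator_compare _ _ _ _ _ _ nu c B (N1 n) theta 1 (N1 n * theta)
    ltac:(lra) HN1 ltac:(lra) Hc HB HF1 HG1 HF2 HG2 Hrho1 Hrho2 HB2) as Q.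
  exact Q. }
split; apply (bigO_sq _ _ HE); revert Main; apply filter_imp; intros n Hn.
- pose proof (pow2_ge_0 (scaled' alpha beta1 n (N1 n * theta) - scaled' alpha beta2 n (N1 n * theta))).
  pose proof (Rle_abs (E n)); unfold N1 in *; lra.
- pose proof (pow2_ge_0 (scaled alpha beta1 n (N1 n * theta) - scaled alpha beta2 n (N1 n * theta))).
  pose proof (Rle_abs (E n)); unfold N1 in *; lra.
Qed.

(** * The case [beta = -1/2] *)

Lemma liouville_reflect alpha n t :
  liouville alpha (- (1 / 2)) n (PI - t) =
  Rpower (cos (t / 2)) (alpha + 1 / 2) * moment 0 alpha (- (1 / 2)) n (cos (t / 2) ^ 2).
Proof.
unfold liouville.
replace ((PI - t) / 2) with (PI / 2 - t / 2) by field.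
rewrite sin_shift, cos_shift.
replace (- (1 / 2) + 1 / 2) with 0 by ring.
replace (Rpower (sin (t / 2)) 0) with 1
  by (unfold Rpower; now rewrite Rmult_0_l, exp_0).
ring.
Qed.

Lemma liouville'_reflect alpha n t :
  liouville' alpha (- (1 / 2)) n (PI - t) =
  Rpower (cos (t / 2)) (alpha + 1 / 2) * (sin (t / 2) / cos (t / 2) *
    (moment 1 alpha (- (1 / 2)) n (cos (t / 2) ^ 2) +
     (alpha + 1 / 2) / 2 * moment 0 alpha (- (1 / 2)) n (cos (t / 2) ^ 2))).
Proof.
unfold liouville'.
replace ((PI - t) / 2) with (PI / 2 - t / 2) by field.
rewrite sin_shift, cos_shift.
replace (- (1 / 2) + 1 / 2) with 0 by ring.
replace (Rpower (sin (t / 2)) 0) with 1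
  by (unfold Rpower; now rewrite Rmult_0_l, exp_0).
unfold Rdiv; ring.
Qed.

Lemma potential_bound_right alpha delta x : 0 < delta <= x -> x < PI ->
  Rabs (potential alpha (- (1 / 2)) x) <=
  Rabs (1 / 4 - alpha ^ 2) / (4 * sin (delta / 2) ^ 2).
Proof.
intros Hd Hx; unfold potential.
replace (_ + _) with ((1 / 4 - alpha ^ 2) * / (4 * sin (x / 2) ^ 2)).
2:{ replace (1 / 4 - (- (1 / 2)) ^ 2) with 0 by field. unfold Rdiv; ring. }
rewrite Rabs_mult; apply Rmult_le_compat_l; [apply Rabs_pos|].
assert (0 < sin (delta / 2)) by (apply sin_gt_0; lra).
assert (sin (delta / 2) <= sin (x / 2)) by (apply sin_incr_1; lra).
assert (sin (delta / 2) ^ 2 <= sin (x / 2) ^ 2) by (apply pow_incr; lra).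
assert (0 < sin (delta / 2) ^ 2) by (apply pow_lt; lra).
rewrite Rabs_right by (apply Rle_ge; left; apply Rinv_0_lt_compat; lra).
apply Rinv_le_contravar; lra.
Qed.

(** At the right endpoint the singular part of the potential vanishes for
    [beta = -1/2]; the solution there is compared with [cos (N * (PI - x))],
    which has the same value and slope at [PI]. *)
Lemma liouville_right alpha delta : -1 < alpha -> 0 < delta < PI ->
  exists C, forall n, 1 <= jacobi_N alpha (- (1 / 2)) n ->
  moment 0 alpha (- (1 / 2)) n 1 <> 0 ->
  forall x, delta <= x < PI ->
  (liouville alpha (- (1 / 2)) n x / moment 0 alpha (- (1 / 2)) n 1
    - cos (jacobi_N alpha (- (1 / 2)) n * (PI - x))) ^ 2 +
  (liouville' alpha (- (1 / 2)) n x / jacobi_N alpha (- (1 / 2)) n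
    / moment 0 alpha (- (1 / 2)) n 1
    - sin (jacobi_N alpha (- (1 / 2)) n * (PI - x))) ^ 2
  <= C / jacobi_N alpha (- (1 / 2)) n ^ 2.
Proof.
intros Ha Hd.
set (c := Rabs (1 / 4 - alpha ^ 2) / (4 * sin (delta / 2) ^ 2)).
assert (Hc : 0 <= c).
{ apply Rmult_le_pos; [apply Rabs_pos|]. left; apply Rinv_0_lt_compat.
  assert (0 < sin (delta / 2)) by (apply sin_gt_0; lra).
  assert (0 < sin (delta / 2) ^ 2) by (apply pow_lt; lra). lra. }
set (P := exp ((c + 2 * c * 1) * PI)).
assert (HP : 0 < P) by apply exp_pos.
exists (P * (2 * c * 1 * PI)).
intros n HN Hp x Hx.
set (N := jacobi_N alpha (- (1 / 2)) n) in *.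
set (p := moment 0 alpha (- (1 / 2)) n 1) in *.
pose (F1 := fun z => liouville alpha (- (1 / 2)) n (PI - z / N) / p).
pose (G1 := fun z => - (liouville' alpha (- (1 / 2)) n (PI - z / N) / N / p)).
pose (Ebar := fun t => (liouville alpha (- (1 / 2)) n (PI - t) / p - cos (N * t)) ^ 2 +
  (liouville' alpha (- (1 / 2)) n (PI - t) / N / p - sin (N * t)) ^ 2).
assert (EN : forall z, N * (z / N) = z) by (intros z; field; lra).
assert (Step : forall t0, 0 < t0 <= PI - x ->
  Ebar (PI - x) <= P * (Ebar t0 + 2 * c * 1 * PI / N ^ 2)).
{ intros t0 Ht0.
  assert (Dom : forall z, N * t0 <= z <= N * (PI - x) ->
      0 < PI - z / N < PI /\ delta <= PI - z / N).
  { intros z [Hz1 Hz2].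
    assert (t0 <= z / N) by (apply (Rmult_le_reg_l N); [lra|]; rewrite EN; lra).
    assert (z / N <= PI - x) by (apply (Rmult_le_reg_l N); [lra|]; rewrite EN; lra).
    lra. }
  pose proof (oscillator_compare F1 G1 cos (fun z => - sin z)
    (fun z => potential alpha (- (1 / 2)) (PI - z / N) / N ^ 2) (fun _ => 0)
    0 c 1 N PI (N * t0) (N * (PI - x))) as Q.
  assert (HNt : 0 < N * t0) by (apply Rmult_lt_0_compat; lra).
  rewrite Rabs_R0 in Q.
  replace (0 / (N * t0)) with 0 in Q by (field; lra). rewrite Rplus_0_l in Q.
  fold P in Q.
  unfold F1, G1 in Q.
  replace (N * (PI - x) / N) with (PI - x) in Q by (field; lra).
  replace (N * t0 / N) with t0 in Q by (field; lra).
  unfold Ebar.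
  replace ((liouville' alpha (- (1 / 2)) n (PI - (PI - x)) / N / p - sin (N * (PI - x))) ^ 2)
    with ((- (liouville' alpha (- (1 / 2)) n (PI - (PI - x)) / N / p) - - sin (N * (PI - x))) ^ 2)
    by ring.
  replace ((liouville' alpha (- (1 / 2)) n (PI - t0) / N / p - sin (N * t0)) ^ 2)
    with ((- (liouville' alpha (- (1 / 2)) n (PI - t0) / N / p) - - sin (N * t0)) ^ 2)
    by ring.
  apply Q; clear Q; try lra.
  - split; [apply Rmult_lt_0_compat; lra | apply Rmult_le_compat_l; lra].
  - rewrite Rmult_comm; apply Rmult_le_compat_r; lra.
  - intros z Hz; destruct (Dom z Hz) as [Dz _].
    evar_last.
    + apply (is_derive_ext (fun z => / p * liouville alpha (- (1 / 2)) n (PI - z / N)));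
        [intros t; unfold Rdiv; apply Rmult_comm|].
      apply is_derive_scal.
      apply (is_derive_comp (liouville alpha (- (1 / 2)) n) (fun t => PI - t / N)).
      * apply is_derive_liouville, Dz.
      * auto_derive; [exact I|reflexivity].
    + unfold scal; simpl; unfold mult; simpl. field; lra.
  - intros z Hz; destruct (Dom z Hz) as [Dz _].
    evar_last.
    + apply (is_derive_ext (fun z => (- / N / p) * liouville' alpha (- (1 / 2)) n (PI - z / N))).
      { intros t; change (- / N / p * liouville' alpha (- (1 / 2)) n (PI - t / N) =
          - (liouville' alpha (- (1 / 2)) n (PI - t / N) / N / p)); field; lra. }
      apply is_derive_scal.
      apply (is_derive_comp (liouville' alpha (- (1 / 2)) n) (fun t => PI - t / N)).
      * apply is_derive_liouville'; [exact Ha | exact Dz].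
      * auto_derive; [exact I|reflexivity].
    + unfold scal; simpl; unfold mult; simpl. fold N.
      assert (N * t0 > 0) by (apply Rmult_lt_0_compat; lra). field; lra.
  - intros z Hz; exact (is_derive_cos z).
  - intros z Hz; auto_derive; [exact I|].
    assert (N * t0 > 0) by (apply Rmult_lt_0_compat; lra). field; lra.
  - intros z Hz; destruct (Dom z Hz) as [Dz Dz'].
    assert (HN2 : 0 < / N ^ 2) by (apply Rinv_0_lt_compat, pow_lt; lra).
    change (Rabs (potential alpha (- (1 / 2)) (PI - z / N) * / N ^ 2) <= c * / N ^ 2).
    rewrite Rabs_mult, (Rabs_right (/ N ^ 2)) by lra.
    apply Rmult_le_compat_r; [lra|].
    apply potential_bound_right; lra.
  - intros z Hz; rewrite Rabs_R0.
    apply Rmult_le_pos; [lra|]. left; apply Rinv_0_lt_compat, pow_lt; lra.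
  - intros z Hz. apply Rabs_le. pose proof (COS_bound z); lra. }
assert (Cont : continuous Ebar 0).
{ apply (continuous_ext (fun t =>
    (Rpower (cos (t / 2)) (alpha + 1 / 2) * moment 0 alpha (- (1 / 2)) n (cos (t / 2) ^ 2)
      / p - cos (N * t)) ^ 2 +
    (Rpower (cos (t / 2)) (alpha + 1 / 2) * (sin (t / 2) / cos (t / 2) *
    (moment 1 alpha (- (1 / 2)) n (cos (t / 2) ^ 2) +
     (alpha + 1 / 2) / 2 * moment 0 alpha (- (1 / 2)) n (cos (t / 2) ^ 2)))
      / N / p - sin (N * t)) ^ 2)).
  { intros t; unfold Ebar. now rewrite liouville_reflect, liouville'_reflect. }
  assert (C1 : cos (0 / 2) = 1) by (replace (0 / 2) with 0 by field; apply cos_0).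
  apply (ex_derive_continuous (V := R_NormedModule)).
  unfold Rpower; auto_derive.
  unfold Rdiv in C1; rewrite C1.
  repeat split; try lra; try exact I;
   (eexists; apply is_derive_moment; simpl; lra). }
assert (E0 : Ebar 0 = 0).
{ unfold Ebar. rewrite liouville_reflect, liouville'_reflect.
  replace (0 / 2) with 0 by field. rewrite Rmult_0_r, cos_0, sin_0.
  replace (Rpower 1 (alpha + 1 / 2)) with 1 by (unfold Rpower; now rewrite ln_1, Rmult_0_r, exp_0).
  replace (1 ^ 2) with 1 by ring. fold p. field; lra. }
assert (Epos : forall t, 0 <= Ebar t)
  by (intros t; apply Rplus_le_le_0_compat; apply pow2_ge_0).
replace (P * (2 * c * 1 * PI) / N ^ 2) with (P * (2 * c * 1 * PI / N ^ 2)) by (field; lra).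
assert (Concl : Ebar (PI - x) <= P * (2 * c * 1 * PI / N ^ 2)).
{ apply le_epsilon; intros eps Heps.
  assert (HeP : 0 < eps / P) by (apply Rdiv_lt_0_compat; lra).
  destruct (proj1 (filterlim_locally Ebar (Ebar 0)) Cont (mkposreal _ HeP)) as [r Hr].
  set (t0 := Rmin (r / 2) (PI - x)).
  assert (Hr0 := cond_pos r).
  assert (Ht0 : 0 < t0) by (apply Rmin_pos; lra).
  assert (Ht1 := Rmin_l (r / 2) (PI - x)). assert (Ht2 := Rmin_r (r / 2) (PI - x)).
  fold t0 in Ht1, Ht2.
  assert (B : Rabs (Ebar t0 - Ebar 0) < eps / P).
  { apply Hr. change (Rabs (t0 - 0) < r). rewrite Rminus_0_r, Rabs_right; lra. }
  rewrite E0, Rminus_0_r, Rabs_right in B by (apply Rle_ge, Epos).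
  eapply Rle_trans; [apply (Step t0); lra|].
  rewrite Rmult_plus_distr_l, Rplus_comm. apply Rplus_le_compat_l.
  replace eps with (P * (eps / P)) by (field; lra).
  apply Rmult_le_compat_l; lra. }
unfold Ebar in Concl. replace (PI - (PI - x)) with x in Concl by ring. exact Concl.
Qed.

(** * Size of the value at 1 *)

Definition harmonic (n : nat) : R := sum_f_R0 (fun k => / INR (S k)) n.

Lemma ln_le_minus_1 x : 0 < x -> ln x <= x - 1.
Proof.
intros Hx. pose proof (exp_ineq1_le (ln x)) as H. rewrite exp_ln in H by exact Hx. lra.
Qed.

Lemma harmonic_bounds n : ln (INR (S n)) <= harmonic n <= 1 + ln (INR (S n)).
Proof.
assert (Hl : forall k, ln (INR (S (S k))) <= ln (INR (S k)) + / INR (S k)).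
{ intros k. assert (0 < INR (S k)) by (apply lt_0_INR; lia).
  assert (0 < INR (S (S k))) by (apply lt_0_INR; lia).
  replace (ln (INR (S (S k)))) with (ln (INR (S k)) + ln (INR (S (S k)) / INR (S k)))
    by (rewrite <- ln_mult by (lra || (apply Rdiv_lt_0_compat; lra)); f_equal; field; lra).
  pose proof (ln_le_minus_1 (INR (S (S k)) / INR (S k)) ltac:(apply Rdiv_lt_0_compat; lra)).
  replace (INR (S (S k)) / INR (S k) - 1) with (/ INR (S k)) in H1
    by (rewrite (S_INR (S k)); field; lra). lra. }
assert (Hu : forall k, ln (INR (S k)) + / INR (S (S k)) <= ln (INR (S (S k)))).
{ intros k. assert (0 < INR (S k)) by (apply lt_0_INR; lia).
  assert (0 < INR (S (S k))) by (apply lt_0_INR; lia).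
  replace (ln (INR (S k))) with (ln (INR (S (S k))) + ln (INR (S k) / INR (S (S k))))
    by (rewrite <- ln_mult by (lra || (apply Rdiv_lt_0_compat; lra)); f_equal; field; lra).
  pose proof (ln_le_minus_1 (INR (S k) / INR (S (S k))) ltac:(apply Rdiv_lt_0_compat; lra)).
  replace (INR (S k) / INR (S (S k)) - 1) with (- / INR (S (S k))) in H1
    by (rewrite (S_INR (S k)) in *; field; lra). lra. }
assert (H : ln (INR (S (S n))) <= harmonic n <= 1 + ln (INR (S n))).
{ induction n as [|n IH].
  - unfold harmonic; simpl sum_f_R0. specialize (Hl 0%nat).
    change (INR 1) with 1 in *. rewrite ln_1, Rinv_1 in *. lra.
  - unfold harmonic in *; rewrite tech5. specialize (Hu n); specialize (Hl (S n)). lra. }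
split; [|lra]. apply Rle_trans with (ln (INR (S (S n)))); [|lra].
specialize (Hu n). assert (0 < / INR (S (S n))) by (apply Rinv_0_lt_compat, lt_0_INR; lia). lra.
Qed.

Lemma jacobi_at_one_S alpha n :
  jacobi_at_one alpha (S n) = jacobi_at_one alpha n * (1 + alpha / INR (S n)).
Proof.
unfold jacobi_at_one; rewrite fact_simpl, mult_INR; simpl pochhammer.
assert (0 < INR (S n)) by (apply lt_0_INR; lia). pose proof (INR_fact_lt_0 n).
rewrite S_INR in *. field; lra.
Qed.

(** The value [(alpha + 1)_n / n!] is the product of the [1 + alpha / j], at most
    [exp (alpha * H_n)], and the harmonic number [H_n] is [ln n] up to a bounded
    error. *)
Lemma jacobi_at_one_bound alpha n : -1 < alpha ->
  jacobi_at_one alpha (S n) <= exp (Rabs alpha) * Rpower (INR (S n)) alpha.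
Proof.
intros Ha.
assert (H : jacobi_at_one alpha (S n) <= exp (alpha * harmonic n)).
{ induction n as [|n IH].
  - unfold jacobi_at_one, harmonic; simpl. pose proof (exp_ineq1_le (alpha * / 1)). lra.
  - rewrite jacobi_at_one_S. unfold harmonic; rewrite tech5; fold (harmonic n).
    rewrite (Rmult_plus_distr_l alpha), exp_plus.
    assert (HS : 2 <= INR (S (S n))) by (rewrite !S_INR; pose proof (pos_INR n); lra).
    assert (Hi : 0 < / INR (S (S n)) <= / 2).
    { split; [apply Rinv_0_lt_compat; lra | apply Rinv_le_contravar; lra]. }
    apply Rmult_le_compat; [left; now apply jacobi_at_one_pos | | exact IH | apply exp_ineq1_le].
    unfold Rdiv; nra. }
eapply Rle_trans; [exact H|].
unfold Rpower; rewrite <- exp_plus.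
assert (L : alpha * harmonic n <= Rabs alpha + alpha * ln (INR (S n))).
{ pose proof (harmonic_bounds n) as Hh.
  destruct (Rle_lt_dec 0 alpha) as [L|L].
  - rewrite Rabs_right by lra. nra.
  - rewrite Rabs_left by lra. nra. }
destruct L as [L| ->]; [left; now apply exp_increasing | lra].
Qed.

(** * Wallis' formula *)

Definition wallis (n : nat) : R := RInt (fun x => sin x ^ n) 0 (PI / 2).

Lemma continuous_sin_pow n x : continuous (fun t => sin t ^ n) x.
Proof.
apply (ex_derive_continuous (V := R_NormedModule)). auto_derive; exact I.
Qed.

Lemma ex_RInt_sin_pow n : ex_RInt (fun x => sin x ^ n) 0 (PI / 2).
Proof. apply (ex_RInt_continuous (V := R_CompleteNormedModule)). intros z _; apply continuous_sin_pow. Qed.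

(** Integration of the derivative of [cos x * sin x ^ (n + 1)]. *)
Lemma wallis_SS n : (INR n + 2) * wallis (S (S n)) = (INR n + 1) * wallis n.
Proof.
assert (H : is_RInt (fun x => (INR n + 1) * sin x ^ n - (INR n + 2) * sin x ^ S (S n)) 0 (PI / 2)
   (cos (PI / 2) * sin (PI / 2) ^ S n - cos 0 * sin 0 ^ S n)).
{ apply (is_RInt_derive (fun x => cos x * sin x ^ S n)).
  - intros x _. auto_derive; [exact I|].
    pose proof (sin2_cos2 x) as E; unfold Rsqr in E.
    replace (match n with O => 1 | S _ => INR n + 1 end) with (INR n + 1)
      by (destruct n; simpl; ring).
    change (sin x ^ S (S n)) with (sin x * (sin x * sin x ^ n)).
    replace ((INR n + 1) * sin x ^ n - (INR n + 2) * (sin x * (sin x * sin x ^ n))) with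
     ((INR n + 1) * sin x ^ n * (sin x * sin x + cos x * cos x)
      - (INR n + 2) * (sin x * (sin x * sin x ^ n))) by (rewrite E; ring).
    ring.
  - intros x _. apply (ex_derive_continuous (V := R_NormedModule)). auto_derive; exact I. }
rewrite cos_PI2, sin_0, Rmult_0_l, pow_i, Rmult_0_r, Rminus_0_r in H by lia.
apply (is_RInt_unique (V := R_CompleteNormedModule)) in H.
rewrite (RInt_minus (V := R_CompleteNormedModule) (fun x => (INR n + 1) * sin x ^ n)
  (fun x => (INR n + 2) * sin x ^ S (S n))) in H.
- rewrite !(RInt_scal (V := R_CompleteNormedModule) (fun x => sin x ^ _)) in H
    by apply ex_RInt_sin_pow.
  unfold wallis, minus, plus, opp, scal in *; simpl in *; unfold mult in *; simpl in *. lra.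
- apply (ex_RInt_scal (V := R_NormedModule)), ex_RInt_sin_pow.
- apply (ex_RInt_scal (V := R_NormedModule)), ex_RInt_sin_pow.
Qed.

Lemma wallis_decr n : wallis (S n) <= wallis n.
Proof.
unfold wallis; apply RInt_le; [pose proof PI_RGT_0; lra | apply ex_RInt_sin_pow ..|].
intros x Hx. pose proof (SIN_bound x). pose proof (sin_ge_0 x ltac:(lra) ltac:(lra)).
simpl. assert (0 <= sin x ^ n) by (apply pow_le; lra). nra.
Qed.

(** The central binomial coefficient of [2n], divided by [4 ^ n]. *)
Definition central (n : nat) : R := jacobi_at_one (- (1 / 2)) n.

Lemma central_S n : (2 * INR n + 2) * central (S n) = (2 * INR n + 1) * central n.
Proof.
unfold central; rewrite jacobi_at_one_S, S_INR. pose proof (pos_INR n). field; lra.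
Qed.

Lemma central_pos n : 0 < central n.
Proof. apply jacobi_at_one_pos; lra. Qed.

Lemma wallis_central n : wallis (2 * n) = central n * (PI / 2) /\
  wallis (2 * n + 1) * (central n * (2 * INR n + 1)) = 1.
Proof.
induction n as [|n [I1 I2]].
- unfold wallis, central, jacobi_at_one; simpl. split.
  + rewrite RInt_const. unfold scal; simpl; unfold mult; simpl. field.
  + replace (RInt (fun x => sin x * 1) 0 (PI / 2)) with (minus (- cos (PI / 2)) (- cos 0)).
    * rewrite cos_PI2, cos_0; unfold minus, plus, opp; simpl. field.
    * symmetry; apply is_RInt_unique, (is_RInt_derive (fun x => - cos x)).
      -- intros x _; auto_derive; [exact I|ring].
      -- intros x _. apply (ex_derive_continuous (V := R_NormedModule)). auto_derive; exact I.
- pose proof (wallis_SS (2 * n)) as W0. pose proof (wallis_SS (2 * n + 1)) as W1.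
  replace (2 * S n)%nat with (S (S (2 * n))) by lia.
  replace (S (S (2 * n)) + 1)%nat with (S (S (2 * n + 1))) by lia.
  assert (Hn := pos_INR n).
  replace (INR (2 * n + 1)) with (2 * INR n + 1) in W1
    by (rewrite plus_INR, mult_INR; simpl; ring).
  replace (INR (2 * n)) with (2 * INR n) in W0 by (rewrite mult_INR; simpl; ring).
  pose proof (central_S n) as HC. rewrite S_INR. split.
  + apply (Rmult_eq_reg_l (2 * INR n + 2)); [|lra]. rewrite W0, I1.
    transitivity ((2 * INR n + 2) * central (S n) * (PI / 2)); [rewrite HC|]; ring.
  + apply (Rmult_eq_reg_l (2 * INR n + 1 + 1)); [|lra].
    replace (2 * INR n + 1 + 2) with (2 * (INR n + 1) + 1) in W1 by ring.
    transitivity ((2 * (INR n + 1) + 1) * wallis (S (S (2 * n + 1))) *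
      ((2 * INR n + 2) * central (S n))); [ring|].
    rewrite W1, HC.
    transitivity ((2 * INR n + 1 + 1) * (wallis (2 * n + 1) * (central n * (2 * INR n + 1))));
      [ring | rewrite I2; ring].
Qed.

(** Monotonicity of the Wallis integrals encloses [PI * n * central n ^ 2]
    between [2n / (2n + 1)] and [4n (n + 1) / (2n + 1) ^ 2]. *)
Lemma approx_central : approx (fun n => Rpower (INR n) (1 / 2) * central n) (/ sqrt PI).
Proof.
assert (HPI := PI_RGT_0).
assert (Hsp := sqrt_lt_R0 PI HPI).
assert (A : approx (fun n => PI * INR n * central n ^ 2) 1).
{ exists 1. generalize eventually_pos; apply filter_imp; intros n Hn.
  destruct (wallis_central n) as [W1 W2]. destruct (wallis_central (S n)) as [W3 _].
  pose proof (wallis_decr (2 * n)) as D1. pose proof (wallis_decr (2 * n + 1)) as D2.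
  replace (S (2 * n)) with (2 * n + 1)%nat in D1 by lia.
  replace (S (2 * n + 1)) with (2 * S n)%nat in D2 by lia.
  rewrite W1 in D1. rewrite W3 in D2.
  pose proof (central_S n) as HC. pose proof (central_pos n) as Hp.
  set (k := central n) in *. set (w := wallis (2 * n + 1)) in *. set (x := INR n) in *.
  assert (Hk : 0 < k * (2 * x + 1)) by (apply Rmult_lt_0_compat; lra).
  assert (L : 1 <= (2 * x + 1) * (PI / 2 * k ^ 2)).
  { apply Rle_trans with (w * (k * (2 * x + 1))); [right; now symmetry|]. replace ((2 * x + 1) * (PI / 2 * k ^ 2)) with
      (k * (PI / 2) * (k * (2 * x + 1))) by ring. apply Rmult_le_compat_r; lra. }
  assert (U : (2 * x + 1) ^ 2 * (PI / 2 * k ^ 2) <= 2 * x + 2).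
  { replace ((2 * x + 1) ^ 2 * (PI / 2 * k ^ 2)) with
     ((2 * x + 2) * central (S n) * (PI / 2) * (k * (2 * x + 1))) by (rewrite HC; ring).
    replace (2 * x + 2) with ((2 * x + 2) * (w * (k * (2 * x + 1)))) at 2 by (rewrite W2; ring).
    replace ((2 * x + 2) * (w * (k * (2 * x + 1)))) with
      ((2 * x + 2) * w * (k * (2 * x + 1))) by ring.
    apply Rmult_le_compat_r; [lra|].
    replace ((2 * x + 2) * central (S n) * (PI / 2)) with
      ((2 * x + 2) * (central (S n) * (PI / 2))) by ring.
    apply Rmult_le_compat_l; lra. }
  set (y := PI * k ^ 2) in *.
  replace (PI / 2 * k ^ 2) with (y / 2) in * by (unfold y; field).
  replace (PI * x * k ^ 2) with (x * y) by (unfold y; ring).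
  assert (Hy : 0 < y) by (unfold y; apply Rmult_lt_0_compat; [lra | apply pow_lt; lra]).
  rewrite Rmult_1_l.
  assert (Hle : x * (x * y - 1) <= 1 /\ -1 <= x * (x * y - 1)) by (split; nra).
  apply Rabs_le; split; apply (Rmult_le_reg_l x); try lra.
  - rewrite <- Ropp_mult_distr_r, Rinv_r by lra. lra.
  - rewrite Rinv_r by lra. lra. }
apply (approx_ext_loc (fun n => / sqrt PI * sqrt (PI * INR n * central n ^ 2))).
- generalize eventually_pos; apply filter_imp; intros n Hn.
  pose proof (central_pos n).
  replace (1 / 2) with (/ 2) by field. rewrite Rpower_sqrt by exact Hn.
  rewrite sqrt_mult by nra. rewrite sqrt_mult, sqrt_pow2 by lra. field; lra.
- assert (Hs : ex_derive sqrt 1) by (auto_derive; lra).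
  pose proof (approx_mult _ _ _ _ (approx_const (/ sqrt PI)) (approx_comp sqrt _ 1 Hs A)) as M.
  rewrite sqrt_1, Rmult_1_r in M; exact M.
Qed.

(** * The Darboux formula *)

Lemma pow_m1_sq n : (-1) ^ n * (-1) ^ n = 1.
Proof. rewrite <- Rpow_mult_distr. replace (-1 * -1) with 1 by ring. apply pow1. Qed.

Lemma cos_sin_nPI n x :
  cos (INR n * PI - x) = (-1) ^ n * cos x /\ sin (INR n * PI - x) = - (-1) ^ n * sin x.
Proof.
induction n as [|n [I1 I2]].
- simpl. replace (0 * PI - x) with (- x) by ring. rewrite cos_neg, sin_neg; split; ring.
- replace (INR (S n) * PI - x) with (INR n * PI - x + PI) by (rewrite S_INR; ring).
  rewrite neg_cos, neg_sin, I1, I2; simpl; split; ring.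
Qed.

Lemma moment0_at_1_central alpha n : -1 < alpha ->
  jacobi_at_one alpha n * moment 0 alpha (- (1 / 2)) n 1 = (-1) ^ n * central n.
Proof.
intros Ha; rewrite moment0_at_1 by exact Ha. unfold jacobi_at_one, central, jacobi_at_one.
pose proof (pochhammer_pos (alpha + 1) n ltac:(lra)). pose proof (INR_fact_lt_0 n).
field; lra.
Qed.

Lemma bigO_jacobi_at_one alpha : -1 < alpha ->
  bigO (fun _ => 1) (fun n => jacobi_at_one alpha n * Rpower (INR n) (- alpha)).
Proof.
intros Ha; exists (exp (Rabs alpha)). exists 1%nat; intros n Hn.
destruct n as [|n]; [lia|].
assert (HP : forall a, 0 < Rpower (INR (S n)) a) by (intros a; apply exp_pos).
rewrite Rabs_right.
2:{ apply Rle_ge, Rmult_le_pos; left; [now apply jacobi_at_one_pos | apply HP]. }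
rewrite Rmult_1_r, Rpower_Ropp.
apply (Rmult_le_reg_r (Rpower (INR (S n)) alpha)); [apply HP|].
rewrite Rmult_assoc, Rinv_l, Rmult_1_r by (apply Rgt_not_eq, HP).
now apply jacobi_at_one_bound.
Qed.

(** At the angle [x = N1 * theta / N2] the phase [N2 * (PI - x)] of
    [liouville_right] equals [n * PI - (N1 * theta + gamma)], where [N1], [N2] are
    the frequencies for [beta] and for [-1/2]: this is where [gamma] comes from.
    The angle tends to [theta], hence stays away from both endpoints. *)
Lemma scaled_half alpha beta theta : -1 < alpha -> -1 < beta -> 0 < theta < PI ->
  exists r r' : nat -> R, bigO (fun n => / INR n) r /\ bigO (fun n => / INR n) r' /\
  eventually (fun n =>
    jacobi_at_one alpha n * scaled alpha (- (1 / 2)) n (jacobi_N alpha beta n * theta) =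
    Rpower (2 * jacobi_N alpha (- (1 / 2)) n) (alpha + 1 / 2) * central n *
      (cos (jacobi_N alpha beta n * theta + jacobi_gamma alpha) + r n) /\
    jacobi_at_one alpha n * scaled' alpha (- (1 / 2)) n (jacobi_N alpha beta n * theta) =
    Rpower (2 * jacobi_N alpha (- (1 / 2)) n) (alpha + 1 / 2) * central n *
      (- sin (jacobi_N alpha beta n * theta + jacobi_gamma alpha) + r' n)).
Proof.
intros Ha Hb Ht.
set (N1 := jacobi_N alpha beta). set (N2 := jacobi_N alpha (- (1 / 2))).
destruct (liouville_right alpha (theta / 2) Ha ltac:(lra)) as [C HC].
pose (p := fun n => moment 0 alpha (- (1 / 2)) n 1).
pose (x := fun n => N1 n * theta / N2 n).
pose (e := fun n => liouville alpha (- (1 / 2)) n (x n) / p n - cos (N2 n * (PI - x n))).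
pose (e' := fun n => liouville' alpha (- (1 / 2)) n (x n) / N2 n / p n - sin (N2 n * (PI - x n))).
assert (Hp : forall n, p n <> 0).
{ intros n H0. pose proof (moment0_at_1_central alpha n Ha) as E. fold (p n) in E.
  rewrite H0, Rmult_0_r in E. pose proof (central_pos n).
  pose proof (pow_nonzero (-1) n ltac:(lra)).
  symmetry in E; apply Rmult_integral in E. lra. }
assert (Ax : approx x theta).
{ apply (approx_ext_loc (fun n => theta * (N1 n / INR n * / (N2 n / INR n)))).
  - generalize (filter_and _ _ eventually_pos (eventually_N_ge alpha (- (1 / 2)) 1)).
    apply filter_imp; intros n [H1 H2]; fold (N2 n) in H2. unfold x; field; lra.
  - replace theta with (theta * (1 * / 1)) at 2 by field.
    assert (M := approx_mult _ _ _ _ (approx_const theta) (approx_mult _ _ _ _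
      (approx_N alpha beta) (approx_inv _ _ R1_neq_R0 (approx_N alpha (- (1 / 2)))))).
    replace (theta * (1 * / 1)) with theta in M by field. exact M. }
assert (Ev : eventually (fun n => 1 <= N2 n /\ e n ^ 2 + e' n ^ 2 <= C / N2 n ^ 2)).
{ generalize (filter_and _ _ (eventually_N_ge alpha (- (1 / 2)) 1)
    (approx_near _ _ (Rmin (theta / 2) (PI - theta)) ltac:(apply Rmin_pos; lra) Ax)).
  apply filter_imp; intros n [H1 H2]. split; [exact H1|].
  apply HC; [exact H1 | apply Hp |].
  pose proof (Rmin_l (theta / 2) (PI - theta)). pose proof (Rmin_r (theta / 2) (PI - theta)).
  apply Rabs_def2 in H2. lra. }
assert (HE : bigO (fun n => / INR n * / INR n) (fun n => C / N2 n ^ 2)).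
{ apply (bigO_ext_loc _ (fun n => C * (/ N2 n * / N2 n))).
  - revert Ev; apply filter_imp; intros n [H _]. field; lra.
  - apply bigO_bounded_l; [apply bigO_const|]. apply bigO_mult; apply bigO_inv_N. }
assert (He : bigO (fun n => / INR n) e).
{ apply (bigO_sq _ _ HE). revert Ev; apply filter_imp; intros n [_ H].
  pose proof (pow2_ge_0 (e' n)). pose proof (Rle_abs (C / N2 n ^ 2)). lra. }
assert (He' : bigO (fun n => / INR n) e').
{ apply (bigO_sq _ _ HE). revert Ev; apply filter_imp; intros n [_ H].
  pose proof (pow2_ge_0 (e n)). pose proof (Rle_abs (C / N2 n ^ 2)). lra. }
assert (Hs : bigO (fun _ => 1) (fun n => (-1) ^ n)).
{ apply (bigO_bounded _ 1); intros n; rewrite pow_1_abs; lra. }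
exists (fun n => (-1) ^ n * e n), (fun n => (-1) ^ n * e' n).
split; [now apply bigO_bounded_l|]. split; [now apply bigO_bounded_l|].
revert Ev; apply filter_imp; intros n [HN _].
set (psi := N1 n * theta).
assert (EN : N2 n * (PI - x n) = INR n * PI - (psi + jacobi_gamma alpha)).
{ unfold x; fold psi. replace (N2 n * (PI - psi / N2 n)) with (N2 n * PI - psi) by (field; lra).
  unfold N2, jacobi_N, jacobi_gamma; field. }
destruct (cos_sin_nPI n (psi + jacobi_gamma alpha)) as [Ec Es].
rewrite <- EN in Ec, Es.
assert (Ek := moment0_at_1_central alpha n Ha). fold (p n) in Ek.
assert (E1 := pow_m1_sq n).
unfold scaled, scaled'. fold (N2 n). change (psi / N2 n) with (x n).
split.
- transitivity (Rpower (2 * N2 n) (alpha + 1 / 2) * (jacobi_at_one alpha n * p n) *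
    (liouville alpha (- (1 / 2)) n (x n) / p n)); [field; apply Hp|].
  replace (liouville alpha (- (1 / 2)) n (x n) / p n) with
    ((-1) ^ n * cos (psi + jacobi_gamma alpha) + e n) by (unfold e; rewrite Ec; ring).
  rewrite Ek.
  transitivity (Rpower (2 * N2 n) (alpha + 1 / 2) * central n *
    ((-1) ^ n * (-1) ^ n * cos (psi + jacobi_gamma alpha) + (-1) ^ n * e n)); [ring|].
  rewrite E1; ring.
- transitivity (Rpower (2 * N2 n) (alpha + 1 / 2) * (jacobi_at_one alpha n * p n) *
    (liouville' alpha (- (1 / 2)) n (x n) / N2 n / p n)); [field; split; [lra | apply Hp]|].
  replace (liouville' alpha (- (1 / 2)) n (x n) / N2 n / p n) with
    (- (-1) ^ n * sin (psi + jacobi_gamma alpha) + e' n) by (unfold e'; rewrite Es; ring).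
  rewrite Ek.
  transitivity (Rpower (2 * N2 n) (alpha + 1 / 2) * central n *
    (- ((-1) ^ n * (-1) ^ n) * sin (psi + jacobi_gamma alpha) + (-1) ^ n * e' n)); [ring|].
  rewrite E1; ring.
Qed.

(** [scaled_compare] replaces the exponent [beta] by [-1/2], for which
    [scaled_half] gives amplitude and phase. *)
Lemma darboux alpha beta theta : -1 < alpha -> -1 < beta -> 0 < theta < PI ->
  bigO (fun n => / INR n) (fun n =>
    Rpower (INR n) (1 / 2) * jacobi_at_one alpha n * liouville alpha beta n theta
    - cos (jacobi_N alpha beta n * theta + jacobi_gamma alpha) / sqrt PI) /\
  bigO (fun n => / INR n) (fun n =>
    Rpower (INR n) (1 / 2) * jacobi_at_one alpha n *
      (liouville' alpha beta n theta / jacobi_N alpha beta n)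
    + sin (jacobi_N alpha beta n * theta + jacobi_gamma alpha) / sqrt PI).
Proof.
intros Ha Hb Ht.
set (N1 := jacobi_N alpha beta). set (N2 := jacobi_N alpha (- (1 / 2))).
set (a := alpha + 1 / 2).
destruct (scaled_half alpha beta theta Ha Hb Ht) as [r [r' [Hr [Hr' Hev]]]].
destruct (scaled_compare alpha beta (- (1 / 2)) theta Ha Hb ltac:(lra) Ht) as [Hd Hd'].
fold N1 in Hd, Hd', Hev. fold N2 in Hev. fold a in Hev.
pose (w1 := fun n => Rpower (INR n) (1 / 2) * jacobi_at_one alpha n * Rpower (2 * N1 n) (- a)).
pose (w2 := fun n => Rpower (INR n) (1 / 2) * central n * Rpower (N2 n / N1 n) a).
assert (EvN : eventually (fun n => 0 < INR n /\ 1 <= N1 n /\ 1 <= N2 n)).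
{ apply filter_and; [apply eventually_pos|]. apply filter_and; apply eventually_N_ge. }
assert (Hw1 : bigO (fun _ => 1) w1).
{ apply (bigO_ext_loc _ (fun n => Rpower 2 (- a) * (jacobi_at_one alpha n * Rpower (INR n) (- alpha)
     * Rpower (N1 n / INR n) (- a)))).
  - revert EvN; apply filter_imp; intros n [H0 [H1 _]]. unfold w1.
    assert (Hq : 0 < N1 n / INR n) by (apply Rdiv_lt_0_compat; lra).
    replace (2 * N1 n) with (2 * (INR n * (N1 n / INR n))) by (field; lra).
    rewrite <- (Rpower_mult_distr 2), <- (Rpower_mult_distr (INR n))
      by (lra || now apply Rmult_lt_0_compat).
    replace (Rpower (INR n) (- alpha)) with (Rpower (INR n) (1 / 2) * Rpower (INR n) (- a))
      by (rewrite <- Rpower_plus; f_equal; unfold a; field).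
    ring.
  - apply bigO_bounded_l; [apply bigO_const|].
    apply bigO_bounded_l; [now apply bigO_jacobi_at_one|].
    apply (approx_bounded _ (Rpower 1 (- a))), approx_Rpower; [lra | apply approx_N]. }
assert (Hw2 : approx w2 (/ sqrt PI)).
{ assert (Aq : approx (fun n => N2 n / N1 n) 1).
  { assert (M := approx_mult _ _ _ _ (approx_N alpha (- (1 / 2)))
       (approx_inv _ _ R1_neq_R0 (approx_N alpha beta))).
    rewrite Rinv_1, Rmult_1_r in M. revert M; apply approx_ext_loc.
    revert EvN; apply filter_imp; intros n [H0 [H1 _]].
    unfold N1, N2 in *; field; lra. }
  assert (M := approx_mult _ _ _ _ approx_central (approx_Rpower _ _ a Rlt_0_1 Aq)).
  replace (Rpower 1 a) with 1 in M by (unfold Rpower; now rewrite ln_1, Rmult_0_r, exp_0).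
  rewrite Rmult_1_r in M. exact M. }
assert (Hcos : bigO (fun _ => 1) (fun n => cos (N1 n * theta + jacobi_gamma alpha))).
{ apply (bigO_bounded _ 1); intros n; apply Rabs_le, COS_bound. }
assert (Hsin : bigO (fun _ => 1) (fun n => - sin (N1 n * theta + jacobi_gamma alpha))).
{ apply bigO_opp, (bigO_bounded _ 1); intros n; apply Rabs_le, SIN_bound. }
(* [w1] undoes the scaling of [liouville beta]; [w2] is the amplitude left by
   [scaled_half] *)
assert (Hscale : forall n, 0 < INR n -> 1 <= N1 n -> 1 <= N2 n ->
  w1 n * (Rpower (2 * N1 n) a) = Rpower (INR n) (1 / 2) * jacobi_at_one alpha n /\
  Rpower (INR n) (1 / 2) * Rpower (2 * N1 n) (- a) * (Rpower (2 * N2 n) a * central n) = w2 n).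
{ intros n H0 H1 H2; unfold w1, w2; split.
  - rewrite Rmult_assoc, <- Rpower_plus, Rplus_opp_l, Rpower_O by lra. ring.
  - assert (0 < N2 n / N1 n) by (apply Rdiv_lt_0_compat; lra).
    replace (2 * N2 n) with (2 * N1 n * (N2 n / N1 n)) by (field; lra).
    rewrite <- (Rpower_mult_distr (2 * N1 n)) by lra.
    transitivity (Rpower (INR n) (1 / 2) * (Rpower (2 * N1 n) (- a) * Rpower (2 * N1 n) a) *
      Rpower (N2 n / N1 n) a * central n); [ring|].
    rewrite <- Rpower_plus, Rplus_opp_l, Rpower_O by lra. ring. }
split.
- apply (bigO_ext_loc _ (fun n => w1 n * (scaled alpha beta n (N1 n * theta)
      - scaled alpha (- (1 / 2)) n (N1 n * theta))
    + ((w2 n - / sqrt PI) * cos (N1 n * theta + jacobi_gamma alpha) + w2 n * r n))).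
  + generalize (filter_and _ _ EvN Hev); apply filter_imp; intros n [[H0 [H1 H2]] [E _]].
    destruct (Hscale n H0 H1 H2) as [S1 S2].
    assert (T1 : w1 n * scaled alpha beta n (N1 n * theta) =
      Rpower (INR n) (1 / 2) * jacobi_at_one alpha n * liouville alpha beta n theta).
    { rewrite <- S1. unfold scaled; fold (N1 n) a.
      replace (N1 n * theta / N1 n) with theta by (field; lra). ring. }
    assert (T2 : w1 n * scaled alpha (- (1 / 2)) n (N1 n * theta) =
      w2 n * (cos (N1 n * theta + jacobi_gamma alpha) + r n)).
    { rewrite <- S2. unfold w1.
      transitivity (Rpower (INR n) (1 / 2) * Rpower (2 * N1 n) (- a) *
        (jacobi_at_one alpha n * scaled alpha (- (1 / 2)) n (N1 n * theta))); [ring|].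
      rewrite E; ring. }
    rewrite <- T1. rewrite Rmult_minus_distr_l, T2. unfold Rdiv; ring.
  + apply bigO_plus; [now apply bigO_bounded_l|]. apply bigO_plus.
    * apply bigO_bounded_r; [exact Hw2 | exact Hcos].
    * apply bigO_bounded_l; [now apply (approx_bounded _ (/ sqrt PI)) | exact Hr].
- apply (bigO_ext_loc _ (fun n => w1 n * (scaled' alpha beta n (N1 n * theta)
      - scaled' alpha (- (1 / 2)) n (N1 n * theta))
    + ((w2 n - / sqrt PI) * - sin (N1 n * theta + jacobi_gamma alpha) + w2 n * r' n))).
  + generalize (filter_and _ _ EvN Hev); apply filter_imp; intros n [[H0 [H1 H2]] [_ E]].
    destruct (Hscale n H0 H1 H2) as [S1 S2].
    assert (T1 : w1 n * scaled' alpha beta n (N1 n * theta) =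
      Rpower (INR n) (1 / 2) * jacobi_at_one alpha n * (liouville' alpha beta n theta / N1 n)).
    { rewrite <- S1. unfold scaled'; fold (N1 n) a.
      replace (N1 n * theta / N1 n) with theta by (field; lra). ring. }
    assert (T2 : w1 n * scaled' alpha (- (1 / 2)) n (N1 n * theta) =
      w2 n * (- sin (N1 n * theta + jacobi_gamma alpha) + r' n)).
    { rewrite <- S2. unfold w1.
      transitivity (Rpower (INR n) (1 / 2) * Rpower (2 * N1 n) (- a) *
        (jacobi_at_one alpha n * scaled' alpha (- (1 / 2)) n (N1 n * theta))); [ring|].
      rewrite E; ring. }
    rewrite <- T1. rewrite Rmult_minus_distr_l, T2. unfold Rdiv; ring.
  + apply bigO_plus; [now apply bigO_bounded_l|]. apply bigO_plus.
    * apply bigO_bounded_r; [exact Hw2 | exact Hsin].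
    * apply bigO_bounded_l; [now apply (approx_bounded _ (/ sqrt PI)) | exact Hr'].
Qed.

(** * The integral as a boundary term *)

Definition jacobi_eigenvalue (alpha beta : R) (n : nat) : R :=
  INR n * (INR n + alpha + beta + 1).

(** The Sturm--Liouville flux [- (1 - t) ^ (alpha + 1) (1 + t) ^ (beta + 1) f'],
    with [f] the normalised Jacobi polynomial: since [moment 1] is
    [- (1 - t) f'], one power of [1 - t] is absorbed. *)
Definition jacobi_flux (alpha beta : R) (n : nat) (t : R) : R :=
  Rpower (1 - t) alpha * Rpower (1 + t) (beta + 1) * moment 1 alpha beta n ((1 - t) / 2).

Lemma is_derive_moment_half i alpha beta n t : t < 1 ->
  is_derive (fun t => moment i alpha beta n ((1 - t) / 2)) t
    (- moment (S i) alpha beta n ((1 - t) / 2) / (1 - t)).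
Proof.
intros Ht; evar_last.
- apply (is_derive_comp (moment i alpha beta n) (fun t => (1 - t) / 2)).
  + apply is_derive_moment; lra.
  + auto_derive; [exact I|reflexivity].
- unfold scal; simpl; unfold mult; simpl. field; lra.
Qed.

Lemma is_derive_Rpower a x : 0 < x ->
  is_derive (fun t => Rpower t a) x (Rpower x a * (a / x)).
Proof.
intros Hx; unfold Rpower; auto_derive; [exact Hx|]. unfold Rdiv; ring.
Qed.

Lemma is_derive_jacobi_flux alpha beta n t : -1 < alpha -> -1 < t < 1 ->
  is_derive (jacobi_flux alpha beta n) t
    (jacobi_eigenvalue alpha beta n * jacobi_weight alpha beta t
     * moment 0 alpha beta n ((1 - t) / 2)).
Proof.
intros Ha Ht.
assert (D1 : is_derive (fun t => Rpower (1 - t) alpha * Rpower (1 + t) (beta + 1)) t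
  (jacobi_weight alpha beta t * (beta + 1 - alpha * (1 + t) / (1 - t)))).
{ assert (D0 : is_derive (fun t => Rpower (1 - t) alpha) t
    (Rpower (1 - t) alpha * (- alpha / (1 - t)))).
  { evar_last.
    - apply (is_derive_comp (fun u => Rpower u alpha) (fun t => 1 - t)).
      + apply is_derive_Rpower; lra.
      + auto_derive; [exact I|reflexivity].
    - unfold scal; simpl; unfold mult; simpl. field; lra. }
  assert (D1 : is_derive (fun t => Rpower (1 + t) (beta + 1)) t
    (Rpower (1 + t) (beta + 1) * ((beta + 1) / (1 + t)))).
  { evar_last.
    - apply (is_derive_comp (fun u => Rpower u (beta + 1)) (fun t => 1 + t)).
      + apply is_derive_Rpower; lra.
      + auto_derive; [exact I|reflexivity].
    - unfold scal; simpl; unfold mult; simpl. field; lra. }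
  evar_last; [exact (is_derive_mult _ _ _ _ _ D0 D1 Rmult_comm)|].
  unfold plus, mult; simpl. unfold jacobi_weight.
  rewrite Rpower_plus, Rpower_1 by lra. field; lra. }
assert (D := is_derive_mult _ _ _ _ _ D1 (is_derive_moment_half 1 alpha beta n t ltac:(lra)) Rmult_comm).
unfold jacobi_flux; evar_last; [exact D|].
unfold plus, mult; simpl. unfold jacobi_eigenvalue, jacobi_weight.
rewrite Rpower_plus, Rpower_1 by lra.
pose proof (moment_ode alpha beta n ((1 - t) / 2) Ha) as O.
set (m0 := moment 0 alpha beta n ((1 - t) / 2)) in *.
set (m1 := moment 1 alpha beta n ((1 - t) / 2)) in *.
set (m2 := moment 2 alpha beta n ((1 - t) / 2)) in *.
set (w := Rpower (1 - t) alpha). set (v := Rpower (1 + t) beta).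
assert (E : (1 + t) * m2 = - 2 * alpha * m1 + (1 - t) * ((alpha + beta + 1) * m1
   - INR n * (INR n + alpha + beta + 1) * m0)) by lra.
transitivity (w * v / (1 - t) * (((beta + 1) * (1 - t) - alpha * (1 + t)) * m1 - (1 + t) * m2)).
- field; lra.
- rewrite E; field; lra.
Qed.

Definition jacobi_wronskian (alpha beta : R) (n m : nat) (t : R) : R :=
  jacobi_flux alpha beta n t * moment 0 alpha beta m ((1 - t) / 2)
  - jacobi_flux alpha beta m t * moment 0 alpha beta n ((1 - t) / 2).

(** Lagrange's identity. *)
Lemma is_derive_jacobi_wronskian alpha beta n m t : -1 < alpha -> -1 < t < 1 ->
  is_derive (jacobi_wronskian alpha beta n m) t
    ((jacobi_eigenvalue alpha beta n - jacobi_eigenvalue alpha beta m) *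
     (jacobi_weight alpha beta t * moment 0 alpha beta n ((1 - t) / 2)
      * moment 0 alpha beta m ((1 - t) / 2))).
Proof.
intros Ha Ht.
assert (H : forall i j, is_derive (fun t => jacobi_flux alpha beta i t
    * moment 0 alpha beta j ((1 - t) / 2)) t
  (jacobi_eigenvalue alpha beta i * jacobi_weight alpha beta t
     * moment 0 alpha beta i ((1 - t) / 2) * moment 0 alpha beta j ((1 - t) / 2)
   + jacobi_flux alpha beta i t * (- moment 1 alpha beta j ((1 - t) / 2) / (1 - t)))).
{ intros i j.
  exact (is_derive_mult _ _ _ _ _ (is_derive_jacobi_flux alpha beta i t Ha Ht)
    (is_derive_moment_half 0 alpha beta j t ltac:(lra)) Rmult_comm). }
unfold jacobi_wronskian; evar_last; [exact (is_derive_minus _ _ _ _ _ (H n m) (H m n))|].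
unfold minus, plus, opp; simpl. unfold jacobi_flux. field; lra.
Qed.

Lemma moment_bounded i alpha beta n : exists K, 0 <= K /\ forall y, 0 <= y <= 1 ->
  Rabs (moment i alpha beta n y) <= K.
Proof.
exists (sum_f_R0 (fun k => Rabs (INR k ^ i * hyp_coef alpha beta n k)) n). split.
- apply cond_pos_sum; intros k; apply Rabs_pos.
- intros y Hy; unfold moment. eapply Rle_trans; [apply Rabs_triang_gen|].
  apply sum_Rle; intros k _. rewrite Rabs_mult, (Rabs_right (y ^ k)) by (apply Rle_ge, pow_le; lra).
  assert (y ^ k <= 1) by (rewrite <- (pow1 k); apply pow_incr; lra).
  pose proof (Rabs_pos (INR k ^ i * hyp_coef alpha beta n k)). nra.
Qed.

(** The polynomial [moment 1] has no constant term; this supplies the factor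
    [1 - t] which makes the flux tend to 0 at 1 even for negative [alpha]. *)
Lemma moment1_linear alpha beta n : exists K, 0 <= K /\ forall y, 0 <= y <= 1 ->
  Rabs (moment 1 alpha beta n y) <= K * y.
Proof.
exists (sum_f_R0 (fun k => Rabs (INR k ^ 1 * hyp_coef alpha beta n k)) n). split.
- apply cond_pos_sum; intros k; apply Rabs_pos.
- intros y Hy; unfold moment. eapply Rle_trans; [apply Rabs_triang_gen|].
  rewrite Rmult_comm, scal_sum. apply sum_Rle; intros k _.
  rewrite Rabs_mult, (Rabs_right (y ^ k)) by (apply Rle_ge, pow_le; lra).
  destruct k as [|k]; [simpl INR; rewrite pow_ne_zero, Rmult_0_l, Rabs_R0 by lia; lra|].
  assert (y ^ S k <= y).
  { simpl. assert (y ^ k <= 1) by (rewrite <- (pow1 k); apply pow_incr; lra). nra. }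
  apply Rmult_le_compat_l; [apply Rabs_pos | assumption].
Qed.

Lemma jacobi_wronskian_lim alpha beta n m : -1 < alpha -> -1 < beta ->
  filterlim (jacobi_wronskian alpha beta n m) (at_left 1) (locally 0).
Proof.
intros Ha Hb.
assert (H : forall i j, exists K, 0 <= K /\ forall t, 0 <= t < 1 ->
  Rabs (jacobi_flux alpha beta i t * moment 0 alpha beta j ((1 - t) / 2)) <=
  K * Rpower (1 - t) (alpha + 1)).
{ intros i j.
  destruct (moment1_linear alpha beta i) as [K1 [HK1 H1]].
  destruct (moment_bounded 0 alpha beta j) as [K0 [HK0 H0]].
  exists (Rpower 2 (beta + 1) * (K1 * K0)). split.
  { apply Rmult_le_pos; [left; apply exp_pos | now apply Rmult_le_pos]. }
  intros t Ht. specialize (H1 ((1 - t) / 2) ltac:(lra)). specialize (H0 ((1 - t) / 2) ltac:(lra)).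
  unfold jacobi_flux.
  assert (P1 : 0 < Rpower (1 - t) alpha) by apply exp_pos.
  assert (P2 : 0 < Rpower (1 + t) (beta + 1)) by apply exp_pos.
  rewrite !Rabs_mult, (Rabs_right (Rpower (1 - t) _)), (Rabs_right (Rpower (1 + t) _)) by lra.
  rewrite (Rpower_plus alpha), Rpower_1 by lra.
  assert (P3 : Rpower (1 + t) (beta + 1) <= Rpower 2 (beta + 1)) by (apply Rle_Rpower_l; lra).
  apply Rle_trans with (Rpower (1 - t) alpha * Rpower 2 (beta + 1) * (K1 * (1 - t)) * K0);
    [|right; ring].
  apply Rmult_le_compat; [|apply Rabs_pos| |exact H0].
  - apply Rmult_le_pos; [apply Rmult_le_pos; lra | apply Rabs_pos].
  - apply Rmult_le_compat; [apply Rmult_le_pos; lra | apply Rabs_pos | |].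
    + apply Rmult_le_compat_l; lra.
    + eapply Rle_trans; [exact H1|]. apply Rmult_le_compat_l; lra. }
destruct (H n m) as [K1 [HK1 H1]]. destruct (H m n) as [K2 [HK2 H2]].
apply filterlim_locally; intros eps.
set (K := K1 + K2 + 1).
assert (He : 0 < eps / K) by (apply Rdiv_lt_0_compat; [apply cond_pos | unfold K; lra]).
set (d := Rpower (eps / K) (/ (alpha + 1))).
assert (Hd : 0 < Rmin d 1) by (apply Rmin_pos; [apply exp_pos | lra]).
exists (mkposreal _ Hd); intros t Bt Lt.
change (Rabs (t - 1) < Rmin d 1) in Bt. change (Rabs (jacobi_wronskian alpha beta n m t - 0) < eps).
rewrite Rabs_left in Bt by lra.
pose proof (Rmin_l d 1); pose proof (Rmin_r d 1).
assert (Pw : Rpower (1 - t) (alpha + 1) < eps / K).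
{ replace (eps / K) with (Rpower d (alpha + 1)).
  - apply Rlt_Rpower_l; lra.
  - unfold d; rewrite Rpower_mult, Rinv_l, Rpower_1 by lra. reflexivity. }
specialize (H1 t ltac:(lra)); specialize (H2 t ltac:(lra)).
assert (P0 : 0 < Rpower (1 - t) (alpha + 1)) by apply exp_pos.
rewrite Rminus_0_r; unfold jacobi_wronskian, Rminus at 1.
eapply Rle_lt_trans; [apply Rabs_triang|]. rewrite Rabs_Ropp.
apply Rle_lt_trans with (K * Rpower (1 - t) (alpha + 1)); [unfold K; nra|].
replace (pos eps) with (K * (eps / K)) by (unfold K; field; lra).
apply Rmult_lt_compat_l; [unfold K; lra | exact Pw].
Qed.

(** The fundamental theorem of calculus with a limit at the upper endpoint. *)
Lemma is_RInt_gen_at_left (F f : R -> R) a b l : a < b ->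
  (forall t, a <= t < b -> is_derive F t (f t)) ->
  (forall t, a <= t < b -> continuous f t) ->
  filterlim F (at_left b) (locally l) ->
  is_RInt_gen f (at_point a) (at_left b) (l - F a).
Proof.
intros Hab HF Hf Hl P HP.
apply (Filter_prod _ _ _ (fun x => x = a) (fun y => a < y < b /\ P (F y - F a))).
- reflexivity.
- apply filter_and.
  + assert (Hd : 0 < b - a) by lra.
    exists (mkposreal _ Hd); intros t Bt Lt. change (Rabs (t - b) < b - a) in Bt.
    rewrite Rabs_left in Bt by lra. lra.
  + apply (filterlim_comp _ _ _ F (fun y => y - F a) (at_left b) (locally l) (locally (l - F a)));
      [exact Hl | | exact HP].
    apply (continuous_minus (V := R_NormedModule) (fun y : R => y) (fun _ => F a));
      [apply continuous_id | apply continuous_const].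
- intros x y -> [Hy Py]; exists (F y - F a); split; [|exact Py]. simpl.
  apply (is_RInt_derive F f); rewrite Rmin_left, Rmax_right by lra.
  + intros t Ht; apply HF; lra.
  + intros t Ht; apply Hf; lra.
Qed.

Lemma eigenvalue_neq alpha beta n m : -1 < alpha -> -1 < beta -> n <> m ->
  jacobi_eigenvalue alpha beta n - jacobi_eigenvalue alpha beta m <> 0.
Proof.
intros Ha Hb Hnm; unfold jacobi_eigenvalue.
replace (_ - _) with ((INR n - INR m) * (INR n + INR m + alpha + beta + 1)) by ring.
apply Rmult_integral_contrapositive_currified.
- intros E. apply Hnm, INR_eq; lra.
- assert (1 <= INR n + INR m) by (rewrite <- plus_INR; change 1 with (INR 1); apply le_INR; lia).
  lra.
Qed.

Lemma is_RInt_gen_jacobi alpha beta n m x0 : -1 < alpha -> -1 < beta -> n <> m -> -1 < x0 < 1 ->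
  is_RInt_gen (jacobi_integrand alpha beta n m) (at_point x0) (at_left 1)
   (- (jacobi_at_one alpha n * jacobi_at_one alpha m
       / (jacobi_eigenvalue alpha beta n - jacobi_eigenvalue alpha beta m)
       * jacobi_wronskian alpha beta n m x0)).
Proof.
intros Ha Hb Hnm Hx.
pose proof (eigenvalue_neq alpha beta n m Ha Hb Hnm) as Hlam.
set (k := jacobi_at_one alpha n * jacobi_at_one alpha m
       / (jacobi_eigenvalue alpha beta n - jacobi_eigenvalue alpha beta m)).
replace (- (k * jacobi_wronskian alpha beta n m x0)) with
  (k * 0 - k * jacobi_wronskian alpha beta n m x0) by ring.
apply (is_RInt_gen_at_left (fun t => k * jacobi_wronskian alpha beta n m t)); [lra | | |].
- intros t Ht; evar_last.
  + apply is_derive_scal, is_derive_jacobi_wronskian; lra.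
  + unfold jacobi_integrand; rewrite !jacobi_moment. unfold k; field; exact Hlam.
- intros t Ht.
  apply (ex_derive_continuous (V := R_NormedModule)).
  apply (ex_derive_ext (fun t => (jacobi_at_one alpha n * moment 0 alpha beta n ((1 - t) / 2)) *
    (jacobi_at_one alpha m * moment 0 alpha beta m ((1 - t) / 2)) * 
    (Rpower (1 - t) alpha * Rpower (1 + t) beta))).
  + intros u; unfold jacobi_integrand; rewrite !jacobi_moment; reflexivity.
  + unfold Rpower; auto_derive.
    repeat split; try lra; (eexists; apply is_derive_moment; lra).
- apply (filterlim_comp _ _ _ (jacobi_wronskian alpha beta n m) (fun y => k * y) _ (locally 0)).
  + now apply jacobi_wronskian_lim.
  + apply (continuous_scal_r (V := R_NormedModule) k (fun y : R => y)), continuous_id.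
Qed.

(** * Conclusion *)

(** In the normal form the Wronskian is a multiple of that of the functions
    [liouville n] and [liouville m], here with the terms for [m] expanded: only
    the one in [liouville' n] is of order [N]. *)
Lemma jacobi_wronskian_cos alpha beta n m theta : 0 < theta < PI ->
  jacobi_wronskian alpha beta n m (cos theta) =
  Rpower 2 (alpha + beta + 1) *
  (Rpower (sin (theta / 2)) (alpha + 1 / 2) * Rpower (cos (theta / 2)) (beta + 1 / 2)) *
  (liouville' alpha beta n theta * moment 0 alpha beta m (sin (theta / 2) ^ 2)
   - liouville alpha beta n theta *
     (cos (theta / 2) / sin (theta / 2) * (moment 1 alpha beta m (sin (theta / 2) ^ 2)
        + (alpha + 1 / 2) / 2 * moment 0 alpha beta m (sin (theta / 2) ^ 2))
      - (beta + 1 / 2) / 2 * (sin (theta / 2) / cos (theta / 2))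
        * moment 0 alpha beta m (sin (theta / 2) ^ 2))).
Proof.
intros Ht; destruct (half_angle_pos theta Ht) as [Hs Hc].
pose proof (sin2_cos2 (theta / 2)) as E; unfold Rsqr in E.
assert (Ec : cos theta = 1 - 2 * (sin (theta / 2) * sin (theta / 2))).
{ replace theta with (2 * (theta / 2)) at 1 by field. rewrite cos_2a_sin; ring. }
unfold jacobi_wronskian, jacobi_flux, liouville, liouville'.
set (s := sin (theta / 2)) in *; set (c := cos (theta / 2)) in *.
replace ((1 - cos theta) / 2) with (s ^ 2) by (rewrite Ec; field).
replace (1 - cos theta) with (2 * (s * s)) by (rewrite Ec; ring).
replace (1 + cos theta) with (2 * (c * c)) by (rewrite Ec; lra).
rewrite <- !Rpower_mult_distr by (try apply Rmult_lt_0_compat; lra).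
replace (alpha + beta + 1) with (alpha + (beta + 1)) by ring.
rewrite !Rpower_plus, (Rpower_1 c) by lra.
assert (Hr : forall x, 0 < x -> Rpower x (1 / 2) * Rpower x (1 / 2) = x).
{ intros x Hx; rewrite <- Rpower_plus. replace (1 / 2 + 1 / 2) with 1 by field. now apply Rpower_1. }
assert (Hs2 := Hr s Hs). assert (Hc2 := Hr c Hc).
symmetry.
transitivity (Rpower 2 alpha * (Rpower 2 beta * Rpower 2 1)
  * (Rpower s alpha * Rpower s alpha) * (Rpower c beta * Rpower c beta)
  * (Rpower s (1 / 2) * Rpower s (1 / 2)) * (Rpower c (1 / 2) * Rpower c (1 / 2))
  * (c / s * (moment 1 alpha beta n (s ^ 2) * moment 0 alpha beta m (s ^ 2)
      - moment 1 alpha beta m (s ^ 2) * moment 0 alpha beta n (s ^ 2)))); [ring|].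
rewrite Hs2, Hc2. field; lra.
Qed.

Lemma approx_eigenvalue_ratio alpha beta m :
  approx (fun n => INR n * jacobi_N alpha beta n /
    (jacobi_eigenvalue alpha beta n - jacobi_eigenvalue alpha beta m)) 1.
Proof.
set (lm := jacobi_eigenvalue alpha beta m).
assert (Hi : approx (fun n => / INR n) 0).
{ exists 1; generalize eventually_pos; apply filter_imp; intros n Hn.
  rewrite Rminus_0_r, Rmult_1_l.
  apply Rinv_0_lt_compat in Hn. rewrite Rabs_right; lra. }
assert (A : approx (fun n => 1 + ((alpha + beta + 1) * / INR n + - lm * (/ INR n * / INR n))) 1).
{ assert (M := approx_plus _ _ _ _ (approx_const 1) (approx_plus _ _ _ _
    (approx_mult _ _ _ _ (approx_const (alpha + beta + 1)) Hi)
    (approx_mult _ _ _ _ (approx_const (- lm)) (approx_mult _ _ _ _ Hi Hi)))).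
  replace (1 + ((alpha + beta + 1) * 0 + - lm * (0 * 0))) with 1 in M by ring. exact M. }
assert (M := approx_mult _ _ _ _ (approx_N alpha beta) (approx_inv _ _ R1_neq_R0 A)).
rewrite Rinv_1, Rmult_1_r in M. revert M; apply approx_ext_loc.
generalize (filter_and _ _ eventually_pos (approx_near _ _ 1 Rlt_0_1 A)).
apply filter_imp; intros n [Hn Hq].
apply Rabs_def2 in Hq.
assert (E : jacobi_eigenvalue alpha beta n - lm =
  INR n ^ 2 * (1 + ((alpha + beta + 1) * / INR n + - lm * (/ INR n * / INR n))))
  by (unfold jacobi_eigenvalue; field; lra).
rewrite E. set (q := 1 + _) in *. field; lra.
Qed.

(* The weight may be unbounded at 1 (when alpha < 0), so the integral over
   [cos theta, 1] is the improper one at its upper endpoint; its existence is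
   asserted because [RInt_gen] is total. *)
Theorem theorem4p2 (alpha beta : R) (halpha : -1 < alpha) (hbeta : -1 < beta)
    (m : nat) (theta : R) (htheta : 0 < theta < PI) :
  (forall n : nat, n <> m ->
     ex_RInt_gen (jacobi_integrand alpha beta n m)
       (at_point (cos theta)) (at_left 1)) /\
  exists C : R, eventually (fun n : nat => n <> m ->
    Rabs (RInt_gen (jacobi_integrand alpha beta n m)
            (at_point (cos theta)) (at_left 1)
          - jacobi_ell alpha beta m theta / Rpower (INR n) (3 / 2)
            * sin (jacobi_N alpha beta n * theta + jacobi_gamma alpha))
    <= C * Rpower (INR n) (- (5 / 2))).
Proof.
assert (Hx : -1 < cos theta < 1).
{ rewrite <- cos_0, <- cos_PI. split; apply cos_decreasing_1; lra. }
pose proof (fun n Hn => is_RInt_gen_jacobi alpha beta n m _ halpha hbeta Hn Hx) as HI.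
split; [intros n Hn; eexists; exact (HI n Hn)|].
set (W := Rpower (sin (theta / 2)) (alpha + 1 / 2) * Rpower (cos (theta / 2)) (beta + 1 / 2)).
set (m0 := moment 0 alpha beta m (sin (theta / 2) ^ 2)).
set (h := cos (theta / 2) / sin (theta / 2) * (moment 1 alpha beta m (sin (theta / 2) ^ 2)
    + (alpha + 1 / 2) / 2 * m0)
  - (beta + 1 / 2) / 2 * (sin (theta / 2) / cos (theta / 2)) * m0).
set (k := Rpower 2 (alpha + beta + 1) * W * jacobi_at_one alpha m).
set (N := jacobi_N alpha beta).
pose (dl := fun n => jacobi_eigenvalue alpha beta n - jacobi_eigenvalue alpha beta m).
pose (Sn := fun n => sin (N n * theta + jacobi_gamma alpha)).
destruct (darboux alpha beta theta halpha hbeta htheta) as [Du Du'].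
pose (v := fun n => Rpower (INR n) (1 / 2) * jacobi_at_one alpha n * liouville alpha beta n theta).
pose (e := fun n => Rpower (INR n) (1 / 2) * jacobi_at_one alpha n *
      (liouville' alpha beta n theta / N n) + Sn n / sqrt PI).
change (bigO (fun n => / INR n) e) in Du'.
assert (Hell : jacobi_ell alpha beta m theta = k * m0 / sqrt PI).
{ unfold jacobi_ell. rewrite jacobi_moment.
  replace ((1 - cos theta) / 2) with (sin (theta / 2) ^ 2).
  2:{ replace theta with (2 * (theta / 2)) at 2 by field. rewrite cos_2a_sin; field. }
  fold m0. unfold k, W, Rdiv; ring. }
assert (Hsin : bigO (fun _ => 1) Sn).
{ apply (bigO_bounded _ 1); intros n; apply Rabs_le, SIN_bound. }
assert (Hv : bigO (fun _ => 1) v).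
{ apply (bigO_ext_loc _ (fun n => (v n - cos (N n * theta + jacobi_gamma alpha) / sqrt PI)
    + cos (N n * theta + jacobi_gamma alpha) * / sqrt PI)).
  - apply filter_forall; intros n; unfold Rdiv; ring.
  - apply bigO_plus; [now apply bigO_inv_bounded|].
    apply bigO_bounded_r; [|apply bigO_const].
    apply (bigO_bounded _ 1); intros n; apply Rabs_le, COS_bound. }
pose (q := fun n => INR n * N n / dl n).
assert (Hq : approx q 1) by apply approx_eigenvalue_ratio.
(* the error, multiplied by [n ^ (3 / 2)] *)
pose (err := fun n => k * m0 / sqrt PI * ((q n - 1) * Sn n) + (- (k * m0)) * (q n * e n)
  + k * h * (q n * v n * / N n)).
assert (Herr : bigO (fun n => / INR n) err).
{ assert (Hq1 := approx_bounded _ _ Hq). unfold err; repeat apply bigO_plus.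
  - apply bigO_bounded_l; [apply bigO_const|]. now apply bigO_bounded_r.
  - apply bigO_bounded_l; [apply bigO_const|]. now apply bigO_bounded_l.
  - apply bigO_bounded_l; [apply bigO_const|].
    apply bigO_bounded_l; [now apply bigO_bounded_l | apply bigO_inv_N]. }
destruct Herr as [C HC]; exists C.
generalize (filter_and _ _ (filter_and _ _ eventually_pos (eventually_N_ge alpha beta 1)) HC).
apply filter_imp; intros n [[Hn HN] Hb] Hnm. fold (N n) in HN.
rewrite (is_RInt_gen_unique _ _ (HI n Hnm)), Hell.
assert (Hdl : dl n <> 0) by now apply eigenvalue_neq.
assert (Hsp := sqrt_lt_R0 PI PI_RGT_0).
set (r := Rpower (INR n) (1 / 2)) in *.
assert (Hr : 0 < r) by apply exp_pos.
assert (E3 : Rpower (INR n) (3 / 2) = INR n * r).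
{ unfold r. rewrite <- (Rpower_1 (INR n) Hn) at 2. rewrite <- Rpower_plus. f_equal; field. }
assert (E5 : Rpower (INR n) (- (5 / 2)) = / (INR n * r) * / INR n).
{ rewrite <- E3, <- Rinv_mult, Rpower_Ropp. f_equal.
  rewrite <- (Rpower_1 (INR n) Hn) at 3. rewrite <- Rpower_plus. f_equal; field. }
rewrite E3, E5, jacobi_wronskian_cos by exact htheta.
fold W m0 h. fold (N n) (dl n) (Sn n).
replace (- (jacobi_at_one alpha n * jacobi_at_one alpha m / dl n *
    (Rpower 2 (alpha + beta + 1) * W *
     (liouville' alpha beta n theta * m0 - liouville alpha beta n theta * h)))
   - k * m0 / sqrt PI / (INR n * r) * Sn n) with (/ (INR n * r) * err n).
2:{ unfold err, q, e, v, k. fold r. field; repeat split; lra || exact Hdl. }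
assert (0 < / (INR n * r)) by (apply Rinv_0_lt_compat, Rmult_lt_0_compat; lra).
rewrite Rabs_mult, Rabs_right by lra.
replace (C * (/ (INR n * r) * / INR n)) with (/ (INR n * r) * (C * / INR n)) by ring.
apply Rmult_le_compat_l; lra.
Qed.
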